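(* Let $n\ge 1$ and let $\alpha_1,\alpha_2,\gamma\in\mathbb{C}$ with $\delta:=\alpha_1\alpha_2-\gamma^2\neq 0$. Let $p\ge 0$ and, for $t=0,1,\dots,p$, let $$f_t(A,B)=\prod_{r=1}^{R_t}A^{k_{t,r}}B^{l_{t,r}}$$ (ordered products, $R_t\ge 0$, $k_{t,r},l_{t,r}$ non-negative integers). Put $$G_0(A,B):=\prod_{1\le u\le p}\operatorname{Tr}f_u(A,B),\qquad G_t(A,B):=\prod_{1\le u\le p,\ u\ne t}\operatorname{Tr}f_u(A,B)\quad(1\le t\le p).$$ Then, with $\langle\cdot\rangle_H$ the Gaussian two-Hermitian-matrix expectation value and with $G_t,f_t$ evaluated at $(M_1,M_2)$, the following two identities hold: $$\begin{aligned} &\alpha_1\langle G_0\operatorname{Tr}(M_1f_0)\rangle_H+\gamma\langle G_0\operatorname{Tr}(M_2f_0)\rangle_H\\ &=\sum_{r=1}^{R_0}\sum_{j=0}^{k_{0,r}-1}\Big\langle G_0\,\operatorname{Tr}\Big(\Big(\prod_{u=1}^{r-1}M_1^{k_{0,u}}M_2^{l_{0,u}}\Big)M_1^{j}\Big)\operatorname{Tr}\Big(M_1^{k_{0,r}-j-1}M_2^{l_{0,r}}\prod_{u=r+1}^{R_0}M_1^{k_{0,u}}M_2^{l_{0,u}}\Big)\Big\rangle_H\\ &\quad+\sum_{t=1}^{p}\sum_{r=1}^{R_t}\sum_{j=0}^{k_{t,r}-1}\Big\langle G_t\,\operatorname{Tr}\Big(\Big(\prod_{u=1}^{r-1}M_1^{k_{t,u}}M_2^{l_{t,u}}\Big)M_1^{j}\,f_0\,M_1^{k_{t,r}-j-1}M_2^{l_{t,r}}\prod_{u=r+1}^{R_t}M_1^{k_{t,u}}M_2^{l_{t,u}}\Big)\Big\rangle_H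 \end{aligned}$$ and $$\begin{aligned} &\alpha_2\langle G_0\operatorname{Tr}(M_2f_0)\rangle_H+\gamma\langle G_0\operatorname{Tr}(M_1f_0)\rangle_H\\ &=\sum_{r=1}^{R_0}\sum_{j=0}^{l_{0,r}-1}\Big\langle G_0\,\operatorname{Tr}\Big(\Big(\prod_{u=1}^{r-1}M_1^{k_{0,u}}M_2^{l_{0,u}}\Big)M_1^{k_{0,r}}M_2^{j}\Big)\operatorname{Tr}\Big(M_2^{l_{0,r}-j-1}\prod_{u=r+1}^{R_0}M_1^{k_{0,u}}M_2^{l_{0,u}}\Big)\Big\rangle_H\\ &\quad+\sum_{t=1}^{p}\sum_{r=1}^{R_t}\sum_{j=0}^{l_{t,r}-1}\Big\langle G_t\,\operatorname{Tr}\Big(\Big(\prod_{u=1}^{r-1}M_1^{k_{t,u}}M_2^{l_{t,u}}\Big)M_1^{k_{t,r}}M_2^{j}\,f_0\,M_2^{l_{t,r}-j-1}\prod_{u=r+1}^{R_t}M_1^{k_{t,u}}M_2^{l_{t,u}}\Big)\Big\rangle_H. \end{aligned}$$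
   Context: $H_n$ is the space of $n\times n$ Hermitian matrices with Lebesgue measure $dM=\prod_i dM_{ii}\prod_{i<j}d\,\mathrm{Re}M_{ij}\,d\,\mathrm{Im}M_{ij}$. For a function $F(A,B)$ of two $n\times n$ matrices which is a polynomial in traces of words in $A,B$, $$\langle F\rangle_H:=\frac{\int_{H_n\times H_n}dM_1\,dM_2\,F(M_1,M_2)\,e^{-\operatorname{Tr}(\frac{\alpha_1}{2}M_1^2+\frac{\alpha_2}{2}M_2^2+\gamma M_1M_2)}}{\int_{H_n\times H_n}dM_1\,dM_2\,e^{-\operatorname{Tr}(\frac{\alpha_1}{2}M_1^2+\frac{\alpha_2}{2}M_2^2+\gamma M_1M_2)}}$$ for those $(\alpha_1,\alpha_2,\gamma)$ for which the integrals converge absolutely, i.e. $\mathrm{Re}(\alpha_1e^{\phi}+\alpha_2e^{-\phi}\pm2\gamma)>0$ for all $\phi\in\mathbb{R}$. There $\langle F\rangle_H$ is a polynomial in $\alpha_1/\delta,\alpha_2/\delta,\gamma/\delta$ (with $\delta=\alpha_1\alpha_2-\gamma^2$), and it is extended by this polynomial expression to all $(\alpha_1,\alpha_2,\gamma)\in\mathbb{C}^3$ with $\delta\ne0$. Empty products of matrices are the identity matrix, and empty products of scalars are $1$. *)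

(* Defs.v *)
From HB Require Import structures.
From mathcomp Require Import all_boot all_order all_algebra.
From mathcomp Require Import all_classical all_reals all_analysis.
From mathcomp Require Import complex.

Set Implicit Arguments.
Unset Strict Implicit.
Unset Printing Implicit Defensive.

Import Order.TTheory GRing.Theory Num.Theory.
Import numFieldNormedType.Exports.

Local Open Scope classical_set_scope.
Local Open Scope complex_scope.
Local Open Scope ring_scope.

Section tuple_measure.
Context d (T : measurableType d) (R : realType).

Definition tcons N (x : T * N.-tuple T) : N.+1.-tuple T :=
  [the N.+1.-tuple T of x.1 :: x.2].

Lemma measurable_tcons N : measurable_fun [set: T * N.-tuple T] (@tcons N).
Proof. exact: measurable_cons. Qed.

Definition tuncons N (t : N.+1.-tuple T) : T * N.-tuple T :=
  (thead t, [tuple of behead t]).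

Lemma tconsK N : cancel (@tcons N) (@tuncons N).
Proof. by case=> x t; congr pair; apply: val_inj. Qed.

Lemma tunconsK N : cancel (@tuncons N) (@tcons N).
Proof. by move=> t; rewrite [RHS]tuple_eta; apply: val_inj. Qed.

Lemma measurable_tuncons N : measurable_fun [set: N.+1.-tuple T] (@tuncons N).
Proof.
apply: measurable_fun_pair; last exact: measurable_behead.
exact: measurable_tnth.
Qed.

Section step.
Variables (N : nat) (m : {sigma_finite_measure set T -> \bar R}).
Variable mu : {sigma_finite_measure set (N.-tuple T) -> \bar R}.

Definition cons_measure : set (N.+1.-tuple T) -> \bar R :=
  pushforward (m \x mu)%E (@tcons N).

Let cons_measure0 : cons_measure set0 = 0%E.
Proof. by rewrite /cons_measure /pushforward preimage_set0 measure0. Qed.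

Let cons_measure_ge0 A : (0 <= cons_measure A)%E.
Proof. exact: (measure_ge0 (m \x mu)%E). Qed.

Let cons_measure_sigma_additive : semi_sigma_additive cons_measure.
Proof.
have mf := @measurable_tcons N.
move=> F mF tF mUF; rewrite /cons_measure /pushforward preimage_bigcup.
apply: measure_semi_sigma_additive.
- by move=> i; rewrite -[X in measurable X]setTI; exact: mf.
- apply/trivIsetP => /= i j _ _ ij; rewrite -preimage_setI.
  by move/trivIsetP : tF => /(_ _ _ _ _ ij) ->//; rewrite preimage_set0.
- by rewrite -preimage_bigcup -[X in measurable X]setTI; exact: mf.
Qed.

HB.instance Definition _ := isMeasure.Build _ _ _ cons_measure
  cons_measure0 cons_measure_ge0 cons_measure_sigma_additive.

Let cons_measure_sigma_finite : sigma_finite setT cons_measure.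
Proof.
have /sigma_finiteP[F [TF ndF Foo]] := sigma_finiteT m.
have /sigma_finiteP[G [TG ndG Goo]] := sigma_finiteT mu.
exists (fun k => @tuncons N @^-1` (F k `*` G k)).
  rewrite -preimage_bigcup (_ : \bigcup_k _ = setT) ?preimage_setT//.
  apply/seteqP; split=> // -[x t] _.
  have [i _ Fix] : (\bigcup_i F i) x by rewrite -TF.
  have [j _ Gjt] : (\bigcup_j G j) t by rewrite -TG.
  exists (maxn i j) => //; split.
  - by move: x Fix; exact/subsetPset/ndF/leq_maxl.
  - by move: t Gjt; exact/subsetPset/ndG/leq_maxr.
move=> k; have [mFk Fkoo] := Foo k; have [mGk Gkoo] := Goo k; split.
  rewrite -[X in measurable X]setTI; apply: measurable_tuncons => //.
  exact: measurableX.
rewrite /cons_measure /pushforward -comp_preimage.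
rewrite (_ : _ \o _ = id); last by apply/funext => x; exact: tconsK.
rewrite preimage_id -[ltLHS]/((m \x mu)%E (F k `*` G k)).
by rewrite product_measure1E// lte_mul_pinfty// ge0_fin_numE.
Qed.

HB.instance Definition _ := Measure_isSigmaFinite.Build _ _ _ cons_measure
  cons_measure_sigma_finite.

End step.

Section base.
Definition nil_measure : set (0.-tuple T) -> \bar R := \d_([tuple] : 0.-tuple T).

HB.instance Definition _ := Measure.on nil_measure.

Let nil_measure_sigma_finite : sigma_finite setT nil_measure.
Proof.
exists (fun=> setT); first by rewrite bigcup_const//; exists 0%N.
by move=> _; split=> //; rewrite /nil_measure diracT ltry.
Qed.

HB.instance Definition _ := Measure_isSigmaFinite.Build _ _ _ nil_measure
  nil_measure_sigma_finite.
End base.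

(* The N-fold product measure m x ... x m on N-tuples: the mass-one measure on
   the singleton type of 0-tuples, then the image of m x m^N under cons. *)
Fixpoint tuple_measure (m : {sigma_finite_measure set T -> \bar R}) N :
    {sigma_finite_measure set (N.-tuple T) -> \bar R} :=
  match N with
  | 0 => nil_measure
  | N'.+1 => cons_measure m (tuple_measure m N')
  end.

Lemma tuple_measure_box (m : {sigma_finite_measure set T -> \bar R}) N
    (A : 'I_N -> set T) : (forall i, measurable (A i)) ->
  (tuple_measure m N [set t | forall i, A i (tnth t i)] =
   \prod_(i < N) m (A i))%E.
Proof.
elim: N A => [|N IHN] A mA.
  rewrite big_ord0 /= /nil_measure diracE mem_set//.
  by case.
rewrite big_ord_recl -IHN//= /cons_measure /pushforward.
rewrite (_ : _ @^-1` _ = A ord0 `*`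
   [set t : N.-tuple T | forall i, A (lift ord0 i) (tnth t i)]); last first.
  apply/seteqP; split=> [[x t] /= xt|[x t] /= [xA tA] i].
    split; first exact: (xt ord0).
    by move=> i; have := xt (lift ord0 i); rewrite tnthS.
  by have [j ->|->] := unliftP ord0 i; [rewrite tnthS; exact: tA|].
rewrite product_measure1E//.
rewrite (_ : [set _ | _] =
  \bigcap_(i in [set: 'I_N]) ((fun t : N.-tuple T => tnth t i) @^-1` A (lift ord0 i))).
  apply: fin_bigcap_measurable => // i _.
  by rewrite -[X in measurable X]setTI; exact: measurable_tnth.
by apply/seteqP; split=> t /= tA i; [move=> _|]; exact: tA.
Qed.

End tuple_measure.

Section gaussian_two_matrix.
Variables (R : realType) (n : nat).
Local Notation C := R[i].
Local Notation coords := ((n * n).-tuple (measurableTypeR R)).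

(* The coordinates of a Hermitian matrix M are M_ii, Re M_ij and Im M_ij for
   i < j; they are stored at positions (i, i), (i, j) and (j, i) respectively. *)
Definition herm_mx (x : coords) : 'M[C]_n :=
  \matrix_(i, j)
    let c a b : R := tnth x (mxvec_index a b) in
    if i == j then (c i i)%:C
    else if (i < j)%N then c i j +i* c j i else c j i -i* c i j.

Lemma herm_mxP (M : 'M[C]_n) :
  (exists x, herm_mx x = M) <-> (forall i j, M j i = conjc (M i j)).
Proof.
split=> [[x <-] i j|MH].
  rewrite !mxE [j == i]eq_sym -(inj_eq val_inj).
  by case: ltngtP => [ij|ji|/val_inj ->]; rewrite /= ?opprK ?oppr0.
pose X : 'M[R]_n := \matrix_(i, j)
  if (i <= j)%N then complex.Re (M i j) else complex.Im (M j i).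
exists [tuple mxvec X 0 k | k < n * n].
apply/matrixP => i j; rewrite mxE /= !tnth_mktuple !mxvecE !mxE.
case: eqVneq => [<-|]; rewrite ?leqnn.
  by have := MH i i; case: (M i i) => a b [] /eqP; rewrite eq_sym eqNr => /eqP ->.
rewrite -(inj_eq val_inj); case: ltngtP => //= ij _.
  by case: (M i j).
by rewrite (MH j i); case: (M j i).
Qed.

(* dM_1 dM_2 on H_n x H_n, in the above coordinates *)
Definition herm2_measure : set (coords * coords) -> \bar R :=
  (tuple_measure (@lebesgue_measure R) (n * n) \x
   tuple_measure (@lebesgue_measure R) (n * n))%E.

(* For complex-valued f this is absolute integrability. *)
Definition cintegrable (f : coords * coords -> C) : Prop :=
  herm2_measure.-integrable setT (fun x => (complex.Re (f x))%:E) /\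
  herm2_measure.-integrable setT (fun x => (complex.Im (f x))%:E).

Definition cintegral (f : coords * coords -> C) : C :=
  Rintegral herm2_measure setT (fun x => complex.Re (f x)) +i*
  Rintegral herm2_measure setT (fun x => complex.Im (f x)).

Definition cexp (z : C) : C :=
  (expR (complex.Re z))%:C * (cos (complex.Im z) +i* sin (complex.Im z)).

Definition gauss_weight (a1 a2 g : C) (A B : 'M[C]_n) : C :=
  cexp (- \tr ((a1 / 2%:R) *: A ^+ 2 + (a2 / 2%:R) *: B ^+ 2 + g *: (A * B))).

Definition gauss_integrand (F : 'M[C]_n -> 'M[C]_n -> C) (a1 a2 g : C)
    (x : coords * coords) : C :=
  F (herm_mx x.1) (herm_mx x.2) *
  gauss_weight a1 a2 g (herm_mx x.1) (herm_mx x.2).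

(* The inequalities are necessary but not quite sufficient for absolute
   convergence: they also hold, for instance, at a1 = g = 0 < a2, where the
   integrals diverge. Hence convergence is required explicitly. *)
Definition gauss_domain (F : 'M[C]_n -> 'M[C]_n -> C) (a1 a2 g : C) : Prop :=
  [/\ forall phi : R,
        0 < complex.Re (a1 * (expR phi)%:C + a2 * (expR (- phi))%:C + 2%:R * g) /\
        0 < complex.Re (a1 * (expR phi)%:C + a2 * (expR (- phi))%:C - 2%:R * g),
      cintegrable (gauss_integrand (fun _ _ => 1) a1 a2 g) &
      cintegrable (gauss_integrand F a1 a2 g)].

Definition gauss_mean (F : 'M[C]_n -> 'M[C]_n -> C) (a1 a2 g : C) : C :=
  cintegral (gauss_integrand F a1 a2 g) /
  cintegral (gauss_integrand (fun _ _ => 1) a1 a2 g).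

Definition delta (a1 a2 g : C) : C := a1 * a2 - g ^+ 2.

Definition horner3 (P : {poly {poly {poly C}}}) (x y z : C) : C :=
  P.[x%:P%:P].[y%:P].[z].

Definition extends_gauss_mean (F : 'M[C]_n -> 'M[C]_n -> C)
    (P : {poly {poly {poly C}}}) : Prop :=
  forall a1 a2 g, gauss_domain F a1 a2 g ->
    let d := delta a1 a2 g in
    gauss_mean F a1 a2 g = horner3 P (a1 / d) (a2 / d) (g / d).

(* The polynomial extension of gauss_mean to all parameters with delta != 0.
   The convergence domain has nonempty interior and the map
   (a1, a2, g) |-> (a1, a2, g) / delta is an involution, so an extending
   polynomial is unique and the choice made by xget is immaterial. *)
Definition expectH (F : 'M[C]_n -> 'M[C]_n -> C) (a1 a2 g : C) : C :=
  let d := delta a1 a2 g in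
  horner3 (xget 0 [set P | extends_gauss_mean F P]) (a1 / d) (a2 / d) (g / d).

(* A^(k_r) B^(l_r) ... A^(k_(s-1)) B^(l_(s-1)): ordered product, 1 if s <= r *)
Definition word (k l : nat -> nat) (r s : nat) (A B : 'M[C]_n) : 'M[C]_n :=
  \prod_(r <= u < s) (A ^+ k u * B ^+ l u).

End gaussian_two_matrix.

(* Main.v *)
Require Import Defs.
From HB Require Import structures.
From mathcomp Require Import all_boot all_order all_algebra.
From mathcomp Require Import all_classical all_reals all_analysis.
From mathcomp Require Import measurable_realfun complex ring lra.

Set Implicit Arguments.
Unset Strict Implicit.
Unset Printing Implicit Defensive.

Import Order.TTheory GRing.Theory Num.Theory.
Import numFieldNormedType.Exports.

(** The parameters for which the integrals converge absolutely are those whose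
    real part is a positive definite form (a degenerate real part leaves the
    integrand constant in modulus along a matrix variable).  In the real
    coordinates of the two Hermitian matrices the Gaussian weight is then a
    product, over the matrix positions, of Gaussian weights on the plane, so
    that the expectation of a monomial is a product of planar moments.
    Integration by parts in the plane gives [a1 <x_k F> + g <y_k F>] and
    [a2 <y_k F> + g <x_k F>] as expectations of derivatives of [F], up to a
    constant.  Solving this system, whose determinant is [delta], shows by
    induction on the degree that [<F>] is a polynomial in [a1 / delta],
    [a2 / delta], [g / delta], and that the integration by parts formula holds
    for the extended expectation at all parameters with [delta <> 0].  Combining
    coordinates into the derivation with respect to a matrix entry and using
    the Leibniz rule for words and traces yields both loop equations.

    The denominator, a complex Gaussian integral, does not vanish: otherwise the
    recursion would kill all moments, and expanding [cos] and [sin] of the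
    imaginary part of the exponent in power series would propagate the vanishing,
    in finitely many small steps, to a weight with real parameters. *)

Local Open Scope classical_set_scope.
Local Open Scope complex_scope.
Local Open Scope ring_scope.

(** * Complex-valued integrals *)

(** The extension to all parameters involves no analytic continuation. Cramer's rule writes the
    expectations of [x_k F] and [y_k F] as explicit combinations of the polynomials extending the
    expectations of derivatives of [F]. As an extending polynomial is unique, these combinations may
    be evaluated wherever [delta] is nonzero, and applying the matrix of the system gives
    integration by parts back. Uniqueness rests on [(a1, a2, g) |-> (a1, a2, g) / delta] being an
    involution: its values at real positive definite triples contain an infinite grid. Integration
    is over real coordinates, but the loop equations differentiate in matrix entries. Each entry is
    a complex combination of coordinates, so derivations along complex vectors are used; an
    off-diagonal coordinate has multiplicity two in the exponent, and the direction of derivation is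
    divided by this multiplicity. In the nonvanishing argument only imaginary parts move, so the
    decay rate of the modulus stays fixed and one step length serves the whole path. *)

Section complex_parts.
Variable R : rcfType.
Implicit Types z w : R[i].

Lemma ReD z w : complex.Re (z + w) = complex.Re z + complex.Re w.
Proof. by case: z w => ? ? [? ?]. Qed.

Lemma ImD z w : complex.Im (z + w) = complex.Im z + complex.Im w.
Proof. by case: z w => ? ? [? ?]. Qed.

Lemma ReM z w : complex.Re (z * w) =
  complex.Re z * complex.Re w - complex.Im z * complex.Im w.
Proof. by case: z w => ? ? [? ?]. Qed.

Lemma ImM z w : complex.Im (z * w) =
  complex.Re z * complex.Im w + complex.Im z * complex.Re w.
Proof. by case: z w => ? ? [? ?]. Qed.

Lemma complex_ext z w :
  complex.Re z = complex.Re w -> complex.Im z = complex.Im w -> z = w.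
Proof. by case: z w => ? ? [? ?] /= -> ->. Qed.

Lemma ReN z : complex.Re (- z) = - complex.Re z. Proof. by case: z. Qed.

Lemma ImN z : complex.Im (- z) = - complex.Im z. Proof. by case: z. Qed.

End complex_parts.

Section complex_integral.
Context d (T : measurableType d) (R : realType).
Variable mu : {measure set T -> \bar R}.
Implicit Types f g : T -> R[i].

Definition integrableC f :=
  mu.-integrable setT (EFin \o (fun x => complex.Re (f x))) /\
  mu.-integrable setT (EFin \o (fun x => complex.Im (f x))).

Definition integralC f : R[i] :=
  Rintegral mu setT (fun x => complex.Re (f x)) +i*
  Rintegral mu setT (fun x => complex.Im (f x)).

Lemma eq_integrableC f g : f =1 g -> integrableC f -> integrableC g.
Proof. by move=> /funext ->. Qed.

Lemma eq_integralC f g : f =1 g -> integralC f = integralC g.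
Proof. by move=> /funext ->. Qed.

Lemma integrableC_D f g :
  integrableC f -> integrableC g -> integrableC (fun x => f x + g x).
Proof.
move=> [f1 f2] [g1 g2]; split.
  by apply: eq_integrable (integrableD _ f1 g1) => // x _ /=; rewrite ReD.
by apply: eq_integrable (integrableD _ f2 g2) => // x _ /=; rewrite ImD.
Qed.

Lemma integralC_D f g : integrableC f -> integrableC g ->
  integralC (fun x => f x + g x) = integralC f + integralC g.
Proof.
move=> [f1 f2] [g1 g2]; rewrite /integralC; apply: complex_ext => /=.
  by rewrite -RintegralD//; apply: eq_Rintegral => x _; rewrite ReD.
by rewrite -RintegralD//; apply: eq_Rintegral => x _; rewrite ImD.
Qed.

Let integrableZ (k : R) (h : T -> R) : mu.-integrable setT (EFin \o h) ->
  mu.-integrable setT (EFin \o (fun x => k * h x)).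
Proof. by move=> ih; apply: eq_integrable (integrableZl _ k ih). Qed.

Lemma integrableC_Z c f : integrableC f -> integrableC (fun x => c * f x).
Proof.
move=> [f1 f2]; split.
  apply: eq_integrable (integrableB _ (integrableZ (complex.Re c) f1)
    (integrableZ (complex.Im c) f2)) => // x _ /=.
  by rewrite ReM.
apply: eq_integrable (integrableD _ (integrableZ (complex.Re c) f2)
  (integrableZ (complex.Im c) f1)) => // x _ /=.
by rewrite ImM.
Qed.

Lemma integralC_Z c f : integrableC f ->
  integralC (fun x => c * f x) = c * integralC f.
Proof.
move=> [f1 f2]; apply: complex_ext; rewrite ?ReM ?ImM /=.
  under eq_Rintegral do rewrite ReM.
  by rewrite RintegralB ?RintegralZl//; exact: integrableZ.
under eq_Rintegral do rewrite ImM.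
by rewrite RintegralD ?RintegralZl//; exact: integrableZ.
Qed.

Lemma integralC_eq0 f : f =1 (fun=> 0) -> integralC f = 0.
Proof.
move=> /funext ->; apply: complex_ext; rewrite /= /Rintegral;
by under eq_integral do rewrite /=; rewrite integral0.
Qed.

End complex_integral.

Section product_integral.
Context d1 d2 (T1 : measurableType d1) (T2 : measurableType d2) (R : realType).
Variable m1 : {sigma_finite_measure set T1 -> \bar R}.
Variable m2 : {sigma_finite_measure set T2 -> \bar R}.

Lemma integrable_prodM (f : T1 -> R) (g : T2 -> R) :
  m1.-integrable setT (EFin \o f) -> m2.-integrable setT (EFin \o g) ->
  (m1 \x m2)%E.-integrable setT (EFin \o (fun z => f z.1 * g z.2)).
Proof.
move=> /[dup] if_ /integrableP[mf foo] /[dup] ig /integrableP[mg goo].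
apply/integrable12ltyP.
  apply/measurable_EFinP; apply: measurable_funM.
    by apply: measurableT_comp => //; apply/measurable_EFinP.
  by apply: measurableT_comp => //; apply/measurable_EFinP.
have -> : (fun x => \int[m2]_y `|(EFin \o (fun z => f z.1 * g z.2)%R) (x, y)|)%E
    = (fun x => `|(EFin \o f) x| * \int[m2]_y `|(EFin \o g) y|)%E.
  apply/funext => x; rewrite -(integralZl _ (integrable_abse ig))//.
  apply: eq_integral => y _; rewrite /= normrM.
  exact: EFinM.
have gfin : (\int[m2]_y `|(EFin \o g) y| \is a fin_num)%E.
  by rewrite ge0_fin_numE// integral_ge0.
under eq_integral do rewrite -(fineK gfin).
rewrite (integralZr _ (integrable_abse if_))//.
rewrite fineK// lte_mul_pinfty ?integral_ge0 ?ge0_fin_numE ?integral_ge0// => x _;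
  exact: abse_ge0.
Qed.

Lemma integrableC_prodM (f : T1 -> R[i]) (g : T2 -> R[i]) :
  integrableC m1 f -> integrableC m2 g ->
  integrableC (m1 \x m2)%E (fun z => f z.1 * g z.2).
Proof.
move=> [f1 f2] [g1 g2]; split.
  apply: eq_integrable (integrableB _ (integrable_prodM f1 g1)
    (integrable_prodM f2 g2)) => // z _ /=.
  by rewrite ReM.
apply: eq_integrable (integrableD _ (integrable_prodM f1 g2)
  (integrable_prodM f2 g1)) => // z _ /=.
by rewrite ImM.
Qed.

Lemma Rintegral12 (h : T1 * T2 -> R) :
  (m1 \x m2)%E.-integrable setT (EFin \o h) ->
  Rintegral (m1 \x m2)%E setT h =
  Rintegral m1 setT (fun x => Rintegral m2 setT (fun y => h (x, y))).
Proof.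
move=> ih; rewrite /Rintegral -integral12_prod_meas1//.
(* On a null set the section may fail to be integrable, and there [fine] turns an infinite inner
   integral into 0; hence only almost everywhere equality. *)
congr fine; apply: ae_eq_integral => //.
- exact: (measurable_fubini_F ih).
- apply/measurable_EFinP; apply: measurableT_comp => //.
  exact: (measurable_fubini_F ih).
apply: filterS (ae_integrable1 ih) => x ix _.
by rewrite /fubini_F fineK//; exact: integrable_fin_num.
Qed.

Lemma integralC12 (h : T1 * T2 -> R[i]) : integrableC (m1 \x m2)%E h ->
  integralC (m1 \x m2)%E h =
  integralC m1 (fun x => integralC m2 (fun y => h (x, y))).
Proof. by move=> [h1 h2]; rewrite /integralC /= !Rintegral12. Qed.

Lemma integralC_prodM (f : T1 -> R[i]) (g : T2 -> R[i]) :
  integrableC m1 f -> integrableC m2 g ->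
  integralC (m1 \x m2)%E (fun z => f z.1 * g z.2) =
  integralC m1 f * integralC m2 g.
Proof.
move=> if_ ig; rewrite integralC12; last exact: integrableC_prodM.
under eq_integralC => x do rewrite /= integralC_Z// mulrC.
by rewrite integralC_Z// mulrC.
Qed.

End product_integral.

Section swap.
Context d (T : measurableType d) (R : realType).
Variable m : {sigma_finite_measure set T -> \bar R}.

Lemma integralC21 (h : T * T -> R[i]) : integrableC (m \x m)%E h ->
  integralC (m \x m)%E h =
  integralC m (fun y => integralC m (fun x => h (x, y))).
Proof.
have Rintegral21 (k : T * T -> R) :
    (m \x m)%E.-integrable setT (EFin \o k) ->
    Rintegral (m \x m)%E setT k =
    Rintegral m setT (fun y => Rintegral m setT (fun x => k (x, y))).
  move=> ih; rewrite /Rintegral -integral21_prod_meas1//.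
  congr fine; apply: ae_eq_integral => //.
  - exact: (measurable_fubini_G ih).
  - apply/measurable_EFinP; apply: measurableT_comp => //.
    exact: (measurable_fubini_G ih).
  apply: filterS (ae_integrable2 ih) => x ix _.
  by rewrite /fubini_G fineK//; exact: integrable_fin_num.
by move=> [h1 h2]; rewrite /integralC /= !Rintegral21.
Qed.

End swap.

(** * Products of tuple measures *)

Section sigma_finite_product.
Context d1 d2 (T1 : measurableType d1) (T2 : measurableType d2) (R : realType).
Variable m1 : {sigma_finite_measure set T1 -> \bar R}.
Variable m2 : {sigma_finite_measure set T2 -> \bar R}.

(* The sigma-finite structure that the library declares on [m1 \x m2] is not
   found by unification, hence this copy. *)
Definition prod_sfm : set (T1 * T2) -> \bar R := (m1 \x m2)%E.

HB.instance Definition _ := Measure.on prod_sfm.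

Let sigma_finite_prod_sfm : sigma_finite setT prod_sfm.
Proof.
have /sigma_finiteP[F [TF ndF Foo]] := sigma_finiteT m1.
have /sigma_finiteP[G [TG ndG Goo]] := sigma_finiteT m2.
exists (fun k => F k `*` G k).
  apply/seteqP; split=> // -[x y] _.
  have [i _ Fix] : (\bigcup_i F i) x by rewrite -TF.
  have [j _ Gjy] : (\bigcup_i G i) y by rewrite -TG.
  exists (maxn i j) => //; split => /=.
    by move: x Fix; exact/subsetPset/ndF/leq_maxl.
  by move: y Gjy; exact/subsetPset/ndG/leq_maxr.
move=> k; have [mFk Fkoo] := Foo k; have [mGk Gkoo] := Goo k.
split; first exact: measurableX.
by rewrite /prod_sfm product_measure1E// lte_mul_pinfty// ge0_fin_numE.
Qed.

HB.instance Definition _ :=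
  Measure_isSigmaFinite.Build _ _ _ prod_sfm sigma_finite_prod_sfm.

End sigma_finite_product.

Section tuple_product.
Context d (T : measurableType d) (R : realType).
Variable m : {sigma_finite_measure set T -> \bar R}.

Let mu N : {sigma_finite_measure set (N.-tuple T) -> \bar R} :=
  tuple_measure m N.

Let mm : {sigma_finite_measure set (T * T)%type -> \bar R} :=
  prod_sfm m m.

Let mumu N :
  {sigma_finite_measure set (N.-tuple T * N.-tuple T)%type -> \bar R} :=
  prod_sfm (mu N) (mu N).

Definition tcons2 N (z : (T * T) * (N.-tuple T * N.-tuple T)) :
    N.+1.-tuple T * N.+1.-tuple T :=
  (tcons (z.1.1, z.2.1), tcons (z.1.2, z.2.2)).

Definition tuncons2 N (z : N.+1.-tuple T * N.+1.-tuple T) :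
    (T * T) * (N.-tuple T * N.-tuple T) :=
  (((tuncons z.1).1, (tuncons z.2).1), ((tuncons z.1).2, (tuncons z.2).2)).

Lemma tuncons2K N : cancel (@tuncons2 N) (@tcons2 N).
Proof.
by move=> [s t]; congr pair; exact: tunconsK.
Qed.

Lemma measurable_tcons2 N : measurable_fun setT (@tcons2 N).
Proof.
apply: measurable_fun_pair; apply: measurableT_comp;
  try exact: measurable_tcons; apply: measurable_fun_pair;
  exact: measurableT_comp.
Qed.

Lemma measurable_tuncons2 N : measurable_fun setT (@tuncons2 N).
Proof.
by do 2 apply: measurable_fun_pair; apply: measurableT_comp => //;
  apply: measurableT_comp => //; exact: measurable_tuncons.
Qed.

Let P N : {measure set ((T * T) * (N.-tuple T * N.-tuple T)) -> \bar R} :=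
  (mm \x mumu N)%E.

Let push N : {measure set (N.+1.-tuple T * N.+1.-tuple T) -> \bar R} :=
  measure_function_pushforward__canonical__measure_function_Measure
    (P N) (@measurable_tcons2 N).

(** Regroups two tuples by position, so that a weight which factorises over positions can be
    integrated one plane at a time. Product measures are determined by rectangles, where the section
    at a pair of heads is itself a rectangle and both sides split. *)
Lemma tuple_measure2_cons N X : measurable X ->
  (mumu N.+1) X =
  pushforward (mm \x mumu N)%E (@tcons2 N) X.
Proof.
move=> mX.
have -> : pushforward (mm \x mumu N)%E (@tcons2 N) =
   push N by [].
apply: product_measure_unique mX => A B mA mB /=.
rewrite /pushforward /cons_measure /pushforward.
pose A' := tcons (N:=N) @^-1` A; pose B' := tcons (N:=N) @^-1` B.
have mA' : measurable A'.
  by rewrite -[X in measurable X]setTI; exact: measurable_tcons.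
have mB' : measurable B'.
  by rewrite -[X in measurable X]setTI; exact: measurable_tcons.
rewrite /product_measure1.
transitivity (\int[mm]_z (mu N (xsection A' z.1) * mu N (xsection B' z.2)))%E.
  apply: eq_integral => -[x y] _ /=; rewrite -product_measure1E//.
  - congr (_ _); apply/seteqP; split=> -[s t];
    by rewrite /xsection /= !inE.
  - exact: measurable_xsection.
  - exact: measurable_xsection.
have mFA : measurable_fun setT (fun x => mu N (xsection A' x)).
  exact: measurable_fun_xsection.
have mFB : measurable_fun setT (fun x => mu N (xsection B' x)).
  exact: measurable_fun_xsection.
rewrite fubini_tonelli1/=; last 2 first.
- apply: emeasurable_funM.
    exact: (measurableT_comp mFA measurable_fst).
  exact: (measurableT_comp mFB measurable_snd).
- by move=> z; rewrite mule_ge0.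
have -> : fubini_F m (fun z => (mu N (xsection A' z.1) * mu N (xsection B' z.2))%E)
    = (fun x => mu N (xsection A' x) * \int[m]_y mu N (xsection B' y))%E.
  by apply/funext => x; rewrite -ge0_integralZl.
by rewrite ge0_integralZr//; exact: integral_ge0.
Qed.

Lemma integrable_tcons2 N (H : N.+1.-tuple T * N.+1.-tuple T -> R) :
  (mm \x mumu N)%E.-integrable setT (EFin \o (H \o @tcons2 N)) ->
  (mumu N.+1).-integrable setT (EFin \o H) /\
  Rintegral (mumu N.+1) setT H =
  Rintegral (mm \x mumu N)%E setT (H \o @tcons2 N).
Proof.
move=> iH.
have mH : measurable_fun setT (EFin \o H).
  have -> : EFin \o H = (EFin \o (H \o @tcons2 N)) \o @tuncons2 N.
    by apply/funext => z /=; rewrite tuncons2K.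
  apply: measurableT_comp (@measurable_tuncons2 N).
  exact: measurable_int iH.
have E (f : _ -> \bar R) :
    (\int[mumu N.+1]_z f z =
     \int[push N]_z f z)%E.
  by apply: eq_measure_integral => A mA _; exact: tuple_measure2_cons.
have iP := @integrable_pushforward _ _ _ _ _ _ (@measurable_tcons2 N) (P N)
  setT _ mH iH measurableT.
split.
  apply/integrableP; split=> //; rewrite E.
  by case/integrableP: iP.
rewrite /Rintegral E; congr fine.
exact: (@integral_pushforward _ _ _ _ _ _ (@measurable_tcons2 N) (P N) setT
  (EFin \o H) mH iH measurableT).
Qed.

Lemma integrableC_tcons2 N (H : N.+1.-tuple T * N.+1.-tuple T -> R[i]) :
  integrableC (mm \x mumu N)%E (H \o @tcons2 N) ->
  integrableC (mumu N.+1) H /\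
  integralC (mumu N.+1) H =
  integralC (mm \x mumu N)%E (H \o @tcons2 N).
Proof.
move=> [i1 i2].
have [h1 e1] := @integrable_tcons2 N (fun z => complex.Re (H z)) i1.
have [h2 e2] := @integrable_tcons2 N (fun z => complex.Im (H z)) i2.
by split; [split | rewrite /integralC e1 e2].
Qed.

Lemma integralC_tuple_prod N (h : 'I_N -> T * T -> R[i]) :
  (forall k, integrableC mm (h k)) ->
  let H z := \prod_k h k (tnth z.1 k, tnth z.2 k) in
  integrableC (mumu N) H /\
  integralC (mumu N) H = \prod_k integralC mm (h k).
Proof.
elim: N h => [|N IHN] h ih /=.
  have muT : (mumu 0) setT = 1%E.
    by rewrite -setXTT /= /prod_sfm product_measure1E//= /nil_measure diracT mule1.
  have -> : (fun z : 0.-tuple T * 0.-tuple T =>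
      \prod_k h k (tnth z.1 k, tnth z.2 k)) = (fun=> 1).
    by apply/funext => z; rewrite big_ord0.
  rewrite big_ord0; split.
    have ic (r : R) : (mumu 0).-integrable setT (EFin \o (fun=> r)).
      apply/integrableP; split; first exact: measurable_cst.
      suff : (\int[mumu 0]_x cst (`|r|%:E) x < +oo)%E by [].
      by rewrite integral_cst// [X in (_ * X)%E]muT mule1 ltry.
    by split; exact: ic.
  by apply: complex_ext; rewrite /= Rintegral_cst// [X in fine X]muT mulr1.
have [iH eH] := IHN (fun k => h (lift ord0 k)) (fun k => ih _).
set H := (fun z => _).
have HE : H \o @tcons2 N = (fun w => h ord0 w.1 *
    \prod_k h (lift ord0 k) (tnth w.2.1 k, tnth w.2.2 k)).
  apply/funext => -[[x y] [s t]]; rewrite /H /= big_ord_recl; congr (_ * _).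
  by apply: eq_bigr => k _; rewrite !tnthS.
have [] := @integrableC_tcons2 N H.
  by rewrite HE; exact: (integrableC_prodM (ih ord0) iH).
move=> iH' ->; split=> //; rewrite HE big_ord_recl -eH.
exact: (integralC_prodM (ih ord0) iH).
Qed.

End tuple_product.

(** * Gaussian integrals in the plane *)

Section real_line.
Variable R : realType.
Implicit Types x y e : R.
Local Notation leb := (@lebesgue_measure R).

(** The fundamental theorem of calculus on the windows [[-n, n]], whose integrals converge to the
    full one by domination by the modulus of [f]. Integer radii explain why decay of [F] is asked
    along integers only. *)
Lemma integral_derive_eq0 (F f : R -> R) :
  (forall x, is_derive x (1:R) F (f x)) -> continuous f ->
  F n%:R @[n --> \oo] --> (0 : R) -> F (- n%:R) @[n --> \oo] --> (0 : R) ->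
  leb.-integrable setT (EFin \o f) -> Rintegral leb setT f = 0.
Proof.
move=> dF cf Fy FNy if_.
have mf := measurable_int _ if_.
pose f_ n := (EFin \o f) \_ `[- n%:R, n%:R].
have [] := @dominated_convergence _ _ _ leb setT measurableT f_ (EFin \o f)
  (abse \o (EFin \o f)).
- move=> n; apply/(measurable_restrictT (EFin \o f)) => //.
  exact: measurable_funS mf.
- exact: mf.
- apply: aeW => x _; apply: cvg_near_cst.
  near=> n; rewrite /f_ patchE ifT// inE /= in_itv /= -ler_norml.
  by near: n; exact: nbhs_infty_ger.
- exact: integrable_abse.
- apply: aeW => x n _; rewrite /f_ patchE.
  by case: ifPn => // _; rewrite abse0 abse_ge0.
move=> _ _ L.
have {L} L : (fun n => (F n%:R - F (- n%:R))%:E) @ \oo -->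
    (\int[leb]_x (EFin \o f) x)%E.
  apply: cvg_trans L; apply: near_eq_cvg; near=> n.
  have n0 : (0 : R) < n%:R by rewrite ltr0n; near: n; exact: nbhs_infty_gt.
  transitivity (\int[leb]_(x in `[(- n%:R)%R, n%:R%R]) (f x)%:E)%E.
    by rewrite [RHS]integral_mkcond.
  rewrite (@continuous_FTC2 _ f F).
  - by rewrite EFinB.
  - by rewrite gtrN.
  - exact: continuous_subspaceT.
  - have cF x : {for x, continuous F}.
      by apply/differentiable_continuous/derivable1_diffP; case: (dF x).
    split.
    + by move=> x _; case: (dF x).
    + by apply: cvg_at_right_filter; exact: cF.
    + by apply: cvg_at_left_filter; exact: cF.
  - by move=> x _; rewrite derive1E; case: (dF x).
have cB : (fun n : nat => F n%:R - F (- n%:R)) @ \oo --> (0 : R).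
  by rewrite -[X in _ --> X](subr0 (0 : R)); apply: (@cvgB _ R).
have L0 : (fun n => (F n%:R - F (- n%:R))%:E) @ \oo --> 0%:E.
  apply: cvg_EFin; first exact: nearW.
  exact: cB.
rewrite /Rintegral.
by have := cvg_unique _ L L0 => /= ->.
Unshelve. all: by end_near. Qed.

Lemma pow_le_gauss e p : 0 < e ->
  exists2 C : R, 0 < C & forall x, `|x| ^+ p <= C * expR (e * x ^+ 2).
Proof.
move=> e0; exists (1 + p`!%:R / e ^+ p).
  by rewrite ltr_pwDl// divr_ge0// exprn_ge0// ltW.
move=> x.
have u0 : 0 <= e * x ^+ 2 by rewrite mulr_ge0 ?sqr_ge0// ltW.
have E1 : 1 <= expR (e * x ^+ 2) by rewrite -expR0 ler_expR.
have E2 : (e * x ^+ 2) ^+ p <= p`!%:R * expR (e * x ^+ 2).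
  case: p => [|p]; first by rewrite expr0 fact0 mul1r.
  rewrite -ler_pdivrMl ?ltr0n ?fact_gt0// mulrC.
  by apply: le_trans (expR_ge1Dxn p u0); rewrite lerDr.
have x2 : `|x| ^+ p <= 1 + x ^+ 2 ^+ p.
  rewrite -normrX -(real_normK (num_real x)) -exprM mulnC exprM normrX.
  by have [] := normr_ge0 x; nra.
apply: le_trans x2 _.
have E3 : x ^+ 2 ^+ p <= p`!%:R / e ^+ p * expR (e * x ^+ 2).
  by rewrite mulrAC ler_pdivlMr ?exprn_gt0// mulrC -exprMn.
by rewrite mulrDl mul1r lerD.
Qed.

Lemma integrable_gauss e : 0 < e ->
  leb.-integrable setT (EFin \o (fun x => expR (- (e * x ^+ 2)))).
Proof.
(* With variance [1 / (2e)] the normal density is a multiple of the given Gaussian. *)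
move=> e0; pose s := Num.sqrt (e *+ 2)^-1.
have s0 : s != 0 by rewrite gt_eqF// sqrtr_gt0 invr_gt0 mulrn_wgt0.
have k0 := normal_peak_gt0 s0.
have ins := integrable_normal_pdf 0 s.
apply: eq_integrable (integrableZl _ (normal_peak s)^-1 ins) => // x _ /=.
rewrite -EFinM normal_pdfE// mulrA mulVf ?gt_eqF// mul1r /normal_fun subr0.
rewrite /s sqr_sqrtr ?invr_ge0 ?mulrn_wge0 ?ltW//.
congr (expR _)%:E; rewrite -mulr_natr; field.
by rewrite gt_eqF.
Qed.

Lemma cvg_gauss_nat e : 0 < e ->
  (fun n : nat => expR (- (e * n%:R ^+ 2))) @ \oo --> (0 : R).
Proof.
move=> e0.
(* By [exp u >= 1 + u] at [u = e N^2], it suffices that [N + 1 <= (2 + 1/e)(1 + e N^2)]; the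
   right-hand side is at least [2 + N^2]. *)
apply: (@squeeze_cvgr _ _ _ _ (fun=> 0)
  (fun n => (2 + e^-1) * (n.+1%:R)^-1)).
- apply: nearW => n; rewrite expR_ge0/= expRN ler_pdivlMr ?ltr0n//.
  rewrite mulrC ler_pdivrMr ?expR_gt0//.
  have := expR_ge1Dx (e * n%:R ^+ 2); rewrite -natr1.
  set E := expR _; set N := (n%:R : R) => uE.
  have i0 : 0 < e^-1 by rewrite invr_gt0.
  have ei : e^-1 * e = 1 by rewrite mulVf// gt_eqF.
  have N0 : 0 <= N by rewrite ler0n.
  apply: (@le_trans _ _ ((2 + e^-1) * (1 + e * N ^+ 2))); last first.
    by rewrite ler_wpM2l// addr_ge0// ltW.
  rewrite mulrDr mulr1 mulrDl mulrA [e^-1 * _]mulrA ei.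
  have : 0 <= 2 * e * N ^+ 2 by rewrite !mulr_ge0 ?sqr_ge0// ltW.
  by have := sqr_ge0 (N - 1); lra.
- exact: cvg_cst.
- rewrite -[X in _ --> X](mulr0 (2 + e^-1)).
  by apply: cvgMl_tmp; exact: cvg_harmonic.
Qed.

End real_line.

Section gauss2.
Variable R : realType.
Local Notation leb := (@lebesgue_measure R).
Local Notation C := R[i].
Local Notation RR := (measurableTypeR R * measurableTypeR R)%type.

Definition qform (a b g x y : R) : R := a / 2 * x ^+ 2 + b / 2 * y ^+ 2 + g * (x * y).

(** Positivity is recorded through an explicit constant [e] because it is the decay rate of the
    dominating Gaussians and the scale of admissible steps in the nonvanishing argument. *)
Definition posdef_form (a b g : C) := exists2 e : R, 0 < e & forall x y,
  e * (x ^+ 2 + y ^+ 2) <= qform (complex.Re a) (complex.Re b) (complex.Re g) x y.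

Definition lebesgue2 : {sigma_finite_measure set RR -> \bar R} := prod_sfm leb leb.

(** The real part ([t = cos]) or the imaginary part ([t = sin]) of a monomial times the complex
    weight; with [t] abstract both are estimated and differentiated at once. *)
Definition gauss_term (t : R -> R) (a b g : C) p q (x y : R) : R :=
  x ^+ p * y ^+ q *
  (expR (- qform (complex.Re a) (complex.Re b) (complex.Re g) x y) *
   t (- qform (complex.Im a) (complex.Im b) (complex.Im g) x y)).

Lemma gauss_term_bound a b g p q : posdef_form a b g ->
  exists e C : R, [/\ 0 < e, 0 < C & forall t, (forall u, `|t u| <= 1) ->
   forall x y, `|gauss_term t a b g p q x y| <=
     C * (expR (- (e * x ^+ 2)) * expR (- (e * y ^+ 2)))].
Proof.
move=> [e e0 qe]; have e20 : 0 < e / 2 by rewrite divr_gt0.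
(* Half of the decay rate absorbs the powers of [x] and [y]; the other half remains in the bound. *)
have [Cp Cp0 hp] := pow_le_gauss p e20.
have [Cq Cq0 hq] := pow_le_gauss q e20.
exists (e / 2), (Cp * Cq); split=> //; first exact: mulr_gt0.
move=> t t1 x y; rewrite /gauss_term !normrM !normrX.
rewrite (ger0_norm (expR_ge0 _)).
set Q := qform _ _ _ _ _; set T := `|t _|.
have -> : expR (- (e / 2 * x ^+ 2)) * expR (- (e / 2 * y ^+ 2)) =
    expR (e / 2 * x ^+ 2) * expR (e / 2 * y ^+ 2) *
    expR (- (e * (x ^+ 2 + y ^+ 2))).
  by rewrite -!expRD; congr expR; field.
have E : expR (- Q) <= expR (- (e * (x ^+ 2 + y ^+ 2))).
  by rewrite ler_expR lerN2; exact: qe.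
apply: (@le_trans _ _ (`|x| ^+ p * `|y| ^+ q * expR (- Q))).
  by rewrite ler_wpM2l ?mulr_ge0 ?exprn_ge0// ler_piMr ?expR_ge0// t1.
rewrite mulrA ler_pM ?mulr_ge0 ?exprn_ge0 ?expR_ge0//.
by rewrite mulrACA ler_pM ?exprn_ge0.
Qed.

Definition unit_bounded (t : R -> R) := continuous t /\ (forall u, `|t u| <= 1).

Lemma unit_bounded_cos : unit_bounded cos.
Proof.
by split; [exact: continuous_cos | move=> u; rewrite ler_norml cos_geN1 cos_le1].
Qed.

Lemma unit_bounded_sin : unit_bounded sin.
Proof.
by split; [exact: continuous_sin | move=> u; rewrite ler_norml sin_geN1 sin_le1].
Qed.

Lemma measurable_qf (a b g : R) :
  measurable_fun [set: RR] (fun z : RR => - qform a b g z.1 z.2).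
Proof.
apply: (measurableT_comp (@oppr_measurable R setT)).
rewrite /qform; apply: measurable_funD; first apply: measurable_funD.
- by apply: measurable_funM => //; apply: measurable_funX.
- by apply: measurable_funM => //; apply: measurable_funX.
- by apply: measurable_funM => //; apply: measurable_funM.
Qed.

Lemma measurable_gauss_term t a b g p q : unit_bounded t ->
  measurable_fun [set: RR] (fun z : RR => gauss_term t a b g p q z.1 z.2).
Proof.
move=> [ct _]; rewrite /gauss_term; apply: measurable_funM; apply: measurable_funM.
- exact: measurable_funX.
- exact: measurable_funX.
- exact: measurableT_comp (measurable_qf _ _ _).
- apply: measurableT_comp (measurable_qf _ _ _).
  exact: continuous_measurable_fun.
Qed.

Lemma integrable_gauss_term t a b g p q : unit_bounded t -> posdef_form a b g ->
  lebesgue2.-integrable setT (EFin \o (fun z : RR => gauss_term t a b g p q z.1 z.2)).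
Proof.
move=> ht /(@gauss_term_bound _ _ _ p q)[e [K [e0 K0 hb]]].
have ig := integrable_prodM (integrable_gauss e0) (integrable_gauss e0).
apply: le_integrable (integrableZl _ K ig) => //.
  by apply/measurable_EFinP; exact: measurable_gauss_term.
move=> z _ /=; rewrite lee_fin; apply: le_trans (ler_norm _).
by apply: hb; case: ht.
Qed.

Lemma integrable_gauss_term1 t a b g p q y : unit_bounded t -> posdef_form a b g ->
  leb.-integrable setT (EFin \o (fun x => gauss_term t a b g p q x y)).
Proof.
move=> ht /(@gauss_term_bound _ _ _ p q)[e [K [e0 K0 hb]]].
have ig := integrable_gauss e0.
apply: le_integrable
  (integrableZl _ (K * expR (- (e * y ^+ 2))) ig) => //.
  apply/measurable_EFinP.
  exact: measurableT_comp (measurable_gauss_term _ _ _ _ _ ht) (measurable_pair2 y).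
move=> x _ /=; rewrite lee_fin; apply: le_trans (ler_norm _).
by rewrite -mulrA [X in K * X]mulrC; apply: hb; case: ht.
Qed.

Lemma is_derive_qf (a b g y x : R) :
  is_derive x (1 : R) (fun x => - qform a b g x y) (- (a * x + g * y)).
Proof.
pose F : R -> R := (- (a / 2)) *: (id ^+ 2) + ((- (g * y)) *: id +
  cst (- (b / 2 * y ^+ 2))).
have -> : (fun x => - qform a b g x y) = F.
  by apply/funext => u; rewrite /F /qform !fctE /=; rewrite /GRing.scale /=; ring.
have dF := is_deriveD (is_deriveZ (- (a / 2)) (is_deriveX 2 (is_derive_id x 1)))
  (is_deriveD (is_deriveZ (- (g * y)) (is_derive_id x 1))
    (is_derive_cst (- (b / 2 * y ^+ 2)) x 1)).
apply: (@is_derive_eq _ _ _ _ _ _ _ _ dF).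
by rewrite /GRing.scale /= expr1; field.
Qed.

(** The truncated [p.-1] is harmless at [p = 0], since its coefficient is then 0; the recursions for
    moments inherit this convention. *)
Lemma is_derive_gauss_term (t t' : R -> R) a b g p q y x :
  (forall u, is_derive u (1 : R) t (t' u)) ->
  is_derive x (1 : R) (fun x => gauss_term t a b g p q x y)
    (p%:R * gauss_term t a b g p.-1 q x y
     - complex.Re a * gauss_term t a b g p.+1 q x y
     - complex.Re g * gauss_term t a b g p q.+1 x y
     - complex.Im a * gauss_term t' a b g p.+1 q x y
     - complex.Im g * gauss_term t' a b g p q.+1 x y).
Proof.
move=> dt.
have dr := is_derive_qf (complex.Re a) (complex.Re b) (complex.Re g) y x.
have ds := is_derive_qf (complex.Im a) (complex.Im b) (complex.Im g) y x.
set r := (fun x => _) in dr; set s := (fun x => _) in ds.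
have dEr : is_derive x (1 : R) (expR \o r)
  (expR (r x) * - (complex.Re a * x + complex.Re g * y)).
  exact: is_derive1_comp.
have dts : is_derive x (1 : R) (t \o s)
  (t' (s x) * - (complex.Im a * x + complex.Im g * y)).
  exact: is_derive1_comp.
pose F : R -> R := (id ^+ p) * cst (y ^+ q) * ((expR \o r) * (t \o s)).
rewrite [X in is_derive _ _ X _](_ : _ = F); last first.
  by apply/funext => u; rewrite /F !fctE /= ?exprfctE.
apply: is_derive_eq.
rewrite /gauss_term -/(r x) -/(s x) /GRing.scale /= !fctE /=.
by rewrite !exprS; case: p F => [|p] F /=; rewrite ?exprS; ring.
Qed.

Lemma continuous_gauss_term t t' a b g p q y :
  (forall u, is_derive u (1 : R) t (t' u)) ->
  continuous (fun x => gauss_term t a b g p q x y).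
Proof.
move=> dt x; apply/differentiable_continuous/derivable1_diffP.
by case: (is_derive_gauss_term a b g p q y x dt).
Qed.

Lemma cvg_gauss_term t a b g p q y (s : R) : unit_bounded t -> posdef_form a b g ->
  s ^+ 2 = 1 ->
  (fun n : nat => gauss_term t a b g p q (s * n%:R) y) @ \oo --> (0 : R).
Proof.
move=> [_ t1] /(@gauss_term_bound _ _ _ p q)[e [K [e0 K0 hb]]] s1.
apply: (@squeeze_cvgr _ _ _ _
  (fun n : nat => - (K * expR (- (e * n%:R ^+ 2))))
  (fun n : nat => K * expR (- (e * n%:R ^+ 2)))).
- apply: nearW => n; rewrite -ler_norml.
  apply: le_trans (hb _ t1 _ _) _; rewrite exprMn s1 mul1r ler_pM2l//.
  rewrite ler_piMr ?expR_ge0// -expR0 ler_expR oppr_le0 mulr_ge0 ?sqr_ge0//.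
  exact: ltW.
- rewrite -[X in _ --> X]oppr0; apply: (@cvgN _ R).
  rewrite -[X in _ --> X](mulr0 K); apply: cvgMl_tmp.
  exact: cvg_gauss_nat.
- rewrite -[X in _ --> X](mulr0 K); apply: cvgMl_tmp.
  exact: cvg_gauss_nat.
Qed.

Lemma integral_gauss_term t t' a b g p q y : unit_bounded t -> unit_bounded t' ->
  (forall u, is_derive u (1 : R) t (t' u)) ->
  (continuous (fun x => gauss_term t' a b g p.+1 q x y)) ->
  (continuous (fun x => gauss_term t' a b g p q.+1 x y)) ->
  posdef_form a b g ->
  Rintegral leb setT (fun x => p%:R * gauss_term t a b g p.-1 q x y
     - complex.Re a * gauss_term t a b g p.+1 q x y
     - complex.Re g * gauss_term t a b g p q.+1 x y
     - complex.Im a * gauss_term t' a b g p.+1 q x y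
     - complex.Im g * gauss_term t' a b g p q.+1 x y) = 0.
Proof.
move=> ht ht' dt c1 c2 pd.
apply: (@integral_derive_eq0 _ (fun x => gauss_term t a b g p q x y)).
- by move=> x; exact: is_derive_gauss_term.
- move=> x; have ct p' q' := @continuous_gauss_term t t' a b g p' q' y dt.
  by do 4 (apply: (@cvgB _ R); last by apply: cvgMl_tmp; (exact: ct || exact: c1 || exact: c2));
    apply: cvgMl_tmp; exact: ct.
- have := @cvg_gauss_term t a b g p q y 1 ht pd (expr1n _ _).
  by under eq_fun do rewrite mul1r.
- have := @cvg_gauss_term t a b g p q y (- 1) ht pd _.
  by rewrite sqrrN expr1n => /(_ erefl); under eq_fun do rewrite mulN1r.
- have intZ k h : leb.-integrable setT (EFin \o h) ->
      leb.-integrable setT (EFin \o (fun x : R => k * h x)).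
    by move=> ih; apply: eq_integrable (integrableZl _ k ih).
  have intB (h h' : R -> R) : leb.-integrable setT (EFin \o h) ->
      leb.-integrable setT (EFin \o h') ->
      leb.-integrable setT (EFin \o (fun x => h x - h' x)).
    by move=> ih ih'; apply: eq_integrable (integrableB _ ih ih').
  apply: (intB); last by apply: (intZ); exact: integrable_gauss_term1.
  apply: (intB); last by apply: (intZ); exact: integrable_gauss_term1.
  apply: (intB); last by apply: (intZ); exact: integrable_gauss_term1.
  apply: (intB); last by apply: (intZ); exact: integrable_gauss_term1.
  by apply: (intZ); exact: integrable_gauss_term1.
Qed.

End gauss2.

(** * Moments of a complex Gaussian weight on the plane *)

Section moments.
Variable R : realType.
Local Notation leb := (@lebesgue_measure R).
Local Notation C := R[i].
Local Notation RR := (measurableTypeR R * measurableTypeR R)%type.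
Implicit Types (a b g : C) (p q : nat).

Definition weight2 a b g (z : RR) : C :=
  cexp ((- qform (complex.Re a) (complex.Re b) (complex.Re g) z.1 z.2) +i*
        (- qform (complex.Im a) (complex.Im b) (complex.Im g) z.1 z.2)).

Definition monomial2 a b g p q (z : RR) : C := (z.1 ^+ p * z.2 ^+ q)%:C * weight2 a b g z.

Definition moment2 a b g p q : C := integralC (lebesgue2 R) (monomial2 a b g p q).

Lemma monomial2E a b g p q z : monomial2 a b g p q z =
  gauss_term cos a b g p q z.1 z.2 +i* gauss_term sin a b g p q z.1 z.2.
Proof.
by rewrite /monomial2 /weight2 /cexp /gauss_term; apply: complex_ext; rewrite /= ?ReM ?ImM /=; ring.
Qed.

Lemma integrableC_monomial2 a b g p q :
  posdef_form a b g -> integrableC (lebesgue2 R) (monomial2 a b g p q).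
Proof.
move=> pd; split.
  apply: eq_integrable (integrable_gauss_term p q (@unit_bounded_cos R) pd) => // z _.
  by rewrite /comp monomial2E.
apply: eq_integrable (integrable_gauss_term p q (@unit_bounded_sin R) pd) => // z _.
by rewrite /comp monomial2E.
Qed.

Lemma gauss_termN (t : R -> R) a b g p q x y :
  gauss_term (fun u => - t u) a b g p q x y = - gauss_term t a b g p q x y.
Proof. by rewrite /gauss_term !mulrN. Qed.

Lemma moment2_rec1 a b g p q : posdef_form a b g ->
  a * moment2 a b g p.+1 q + g * moment2 a b g p q.+1 = p%:R * moment2 a b g p.-1 q.
Proof.
move=> pd; have im := integrableC_monomial2 _ _ pd.
(* [D] is the derivative in [x] of the weighted monomial. Integrating over [x] first, for fixed [y],
   makes every inner integral vanish. *)
pose D z := p%:R * monomial2 a b g p.-1 q z + (- a * monomial2 a b g p.+1 q z +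
  - g * monomial2 a b g p q.+1 z).
have iD : integrableC (lebesgue2 R) D.
  by apply: integrableC_D; [|apply: integrableC_D]; apply: integrableC_Z.
have : integralC (lebesgue2 R) D = 0.
  rewrite [LHS](integralC21 iD); apply: integralC_eq0 => y.
  have dN (u : R) : is_derive u (1 : R) (fun u => - sin u) (- cos u).
    by apply: is_deriveN; exact: is_derive_sin.
  have tN : unit_bounded (fun u : R => - sin u).
    split; last by move=> u; rewrite normrN; apply: (unit_bounded_sin R).2.
    by move=> u; apply: (@cvgN _ R); exact: (unit_bounded_sin R).1.
  have natRe : complex.Re (p%:R : C) = p%:R.
    by rewrite -(rmorph_nat (real_complex R)).
  have natIm : complex.Im (p%:R : C) = 0.
    by rewrite -(rmorph_nat (real_complex R)).
  apply: complex_ext.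
    change (Rintegral leb setT (fun x => complex.Re (D (x, y))) = 0).
    rewrite -[RHS](@integral_gauss_term R cos (fun u => - sin u) a b g p q y
      (@unit_bounded_cos R) tN (@is_derive_cos R) _ _ pd).
    - apply: eq_Rintegral => x _.
      rewrite /D !monomial2E !ReD !ReM !ReN !ImN !gauss_termN natRe natIm /=; ring.
    - by apply: (@continuous_gauss_term _ _ (fun u => - cos u)); exact: dN.
    - by apply: (@continuous_gauss_term _ _ (fun u => - cos u)); exact: dN.
  change (Rintegral leb setT (fun x => complex.Im (D (x, y))) = 0).
  rewrite -[RHS](@integral_gauss_term R sin cos a b g p q y
    (@unit_bounded_sin R) (@unit_bounded_cos R) (@is_derive_sin R) _ _ pd).
  - apply: eq_Rintegral => x _.
    rewrite /D !monomial2E !ImD !ImM !ReN !ImN natRe natIm /=; ring.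
  - by apply: (@continuous_gauss_term _ _ (fun u => - sin u)); exact: is_derive_cos.
  - by apply: (@continuous_gauss_term _ _ (fun u => - sin u)); exact: is_derive_cos.
rewrite integralC_D; [|by apply: integrableC_Z|]; last first.
  by apply: integrableC_D; apply: integrableC_Z.
rewrite integralC_D; [|by apply: integrableC_Z|by apply: integrableC_Z].
rewrite !integralC_Z// => /eqP; rewrite addr_eq0 => /eqP E.
by rewrite /moment2 E; ring.
Qed.

Lemma qformC (a b g x y : R) : qform b a g y x = qform a b g x y.
Proof. by rewrite /qform; ring. Qed.

Lemma posdef_formC a b g : posdef_form a b g -> posdef_form b a g.
Proof. by move=> [e e0 h]; exists e => // x y; rewrite qformC addrC. Qed.

Lemma moment2C a b g p q : posdef_form a b g -> moment2 a b g p q = moment2 b a g q p.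
Proof.
move=> pd; rewrite /moment2 [LHS](integralC21 (integrableC_monomial2 p q pd)).
rewrite [RHS](integralC12 (integrableC_monomial2 q p (posdef_formC pd))).
apply: eq_integralC => y; apply: eq_integralC => x.
by rewrite /monomial2 /weight2 /= !(qformC _ _ _ x y) [_ ^+ q * _]mulrC.
Qed.

Lemma moment2_rec2 a b g p q : posdef_form a b g ->
  b * moment2 a b g p q.+1 + g * moment2 a b g p.+1 q = q%:R * moment2 a b g p q.-1.
Proof. by move=> pd; rewrite ![moment2 a b g _ _]moment2C//; exact/moment2_rec1/posdef_formC. Qed.

(** If the determinant of the symmetric matrix with rows [(a, g)] and [(g, b)] vanished, the vector
    [v = (-g, a)] would be in its kernel. But the real quadratic form, evaluated at [Re v] and at
    [Im v] and summed, is half the real part of the conjugate of [a] times the determinant, and this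
    sum is positive because [Re a] is nonzero. *)
Lemma posdef_form_det a b g : posdef_form a b g -> a * b - g ^+ 2 != 0.
Proof.
move=> [e e0 pd]; apply/eqP.
move: a b g pd => [ar ai] [br bi] [gr gi] /= pd [E1 E2].
have Q (x y : R) : x != 0 -> 0 < qform ar br gr x y.
  move=> x0; apply: lt_le_trans (pd x y).
  by rewrite mulr_gt0// ltr_pwDl ?sqr_ge0// lt_def sqr_ge0 sqrf_eq0 x0.
have Q0 (x y : R) : 0 <= qform ar br gr x y.
  by apply: le_trans (pd x y); rewrite mulr_ge0 ?addr_ge0 ?sqr_ge0// ltW.
have ar0 : ar != 0.
  by have := Q 1 0 (oner_neq0 _); rewrite /qform; apply: contraTneq => ->; rewrite -leNgt; nra.
have : 0 < qform ar br gr (- gr) ar + qform ar br gr (- gi) ai.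
  apply: ltr_pwDl => //.
  apply: lt_le_trans (pd _ _).
  by rewrite mulr_gt0// ltr_pwDr ?sqr_ge0// lt_def sqr_ge0 sqrf_eq0 ar0.
rewrite (_ : qform _ _ _ _ _ + _ = (ar * (ar * br - ai * bi - (gr * gr - gi * gi)) +
   ai * (ar * bi + ai * br - (gr * gi + gi * gr))) / 2).
  by rewrite E1 E2 !mulr0 addr0 mul0r ltxx.
by rewrite /qform; field.
Qed.

(** Cramer's rule on the two recursions: moments of total degree [p' + q' + 1] are determined by
    moments whose degree is lower by two. *)
Lemma moment2_eq0 a b g p q : posdef_form a b g -> moment2 a b g 0 0 = 0 ->
  moment2 a b g p q = 0.
Proof.
move=> pd m0; have d0 := posdef_form_det pd.
have [n] := ubnP (p + q)%N; elim: n p q => // n IHn p q.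
have K p' q' : (p' + q' < n)%N ->
    moment2 a b g p'.+1 q' = 0 /\ moment2 a b g p' q'.+1 = 0.
  move=> lt_n; have e1 := moment2_rec1 p' q' pd; have e2 := moment2_rec2 p' q' pd.
  have z1 : p'%:R * moment2 a b g p'.-1 q' = 0.
    case: p' lt_n {e1 e2} => [|p'] lt_n; first by rewrite mul0r.
    by rewrite IHn ?mulr0//; exact: ltn_trans lt_n.
  have z2 : q'%:R * moment2 a b g p' q'.-1 = 0.
    case: q' lt_n {e1 e2 z1} => [|q'] lt_n; first by rewrite mul0r.
    by rewrite IHn ?mulr0//; apply: ltn_trans lt_n; rewrite addnS.
  rewrite z1 in e1; rewrite z2 in e2.
  split; apply: (mulfI d0); rewrite mulr0.
    transitivity (b * (a * moment2 a b g p'.+1 q' + g * moment2 a b g p' q'.+1) -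
      g * (b * moment2 a b g p' q'.+1 + g * moment2 a b g p'.+1 q')); first by ring.
    by rewrite e1 e2 !mulr0 subr0.
  transitivity (a * (b * moment2 a b g p' q'.+1 + g * moment2 a b g p'.+1 q') -
    g * (a * moment2 a b g p'.+1 q' + g * moment2 a b g p' q'.+1)); first by ring.
  by rewrite e1 e2 !mulr0 subr0.
case: p => [|p] lt_n; last by case: (K p q lt_n).
case: q lt_n => [//|q] lt_n; by case: (K 0 q lt_n).
Qed.

End moments.

(** * Nonvanishing of the complex Gaussian integral *)

Section entire_series.
Context d (T : measurableType d) (R : realType).
Variable mu : {measure set T -> \bar R}.

Lemma series_expR_le (t : R) n : 0 <= t ->
  \sum_(0 <= k < n) t ^+ k / k`!%:R <= expR t.
Proof.
move=> t0.
have h : nondecreasing_seq (series (exp_coeff t)).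
  by apply: nondecreasing_series => k _ _; rewrite /exp_coeff divr_ge0// exprn_ge0.
have := nondecreasing_cvgn_le h (@is_cvg_series_exp_coeff R t) n.
by rewrite /expR.
Qed.

(** Termwise integration of the power series [phi(Y)] against [u]: since [|c k| <= 1 / k!], all
    partial sums are dominated by [exp |Y| |u|], hence by [G]. *)
Lemma integral_entire_eq0 (Y u G : T -> R) (c : nat -> R) (phi : R -> R) :
  (forall t, (fun n => \sum_(0 <= k < n) c k * t ^+ k) @ \oo --> phi t) ->
  (forall k, `|c k| <= (k`!%:R)^-1) ->
  (forall k, mu.-integrable setT (EFin \o (fun x => Y x ^+ k * u x)) /\
    Rintegral mu setT (fun x => Y x ^+ k * u x) = 0) ->
  mu.-integrable setT (EFin \o G) ->
  (forall x, expR `|Y x| * `|u x| <= G x) ->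
  measurable_fun setT (fun x => phi (Y x) * u x) ->
  mu.-integrable setT (EFin \o (fun x => phi (Y x) * u x)) /\
  Rintegral mu setT (fun x => phi (Y x) * u x) = 0.
Proof.
move=> cphi cb hY iG hG mphi.
pose f_ n x := (\sum_(0 <= k < n) c k%N * (Y x ^+ k * u x))%R.
have if_ n : mu.-integrable setT (EFin \o f_ n) /\ Rintegral mu setT (f_ n) = 0.
  elim: n => [|n [IH1 IH2]].
    have -> : f_ 0%N = cst 0 by apply/funext => x; rewrite /f_ big_nil.
    split; first exact: integrable0.
    by rewrite /Rintegral integral0.
  have -> : f_ n.+1 = (fun x => f_ n x + c n * (Y x ^+ n * u x)).
    by apply/funext => x; rewrite /f_ big_nat_recr.
  have [h1 h2] := hY n.
  have h3 : mu.-integrable setT (EFin \o (fun x => c n * (Y x ^+ n * u x))).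
    by apply: eq_integrable (integrableZl _ (c n) h1).
  split; first by apply: eq_integrable (integrableD _ IH1 h3).
  by rewrite RintegralD// RintegralZl// IH2 h2 mulr0 addr0.
have [] := @dominated_convergence _ _ _ mu setT measurableT
  (fun n => EFin \o f_ n) (EFin \o (fun x => phi (Y x) * u x)) (EFin \o G).
- by move=> n; case: (if_ n) => /measurable_int.
- exact/measurable_EFinP.
- apply: aeW => x _; apply: cvg_EFin; first exact: nearW.
  have -> : fine \o (fun n => (EFin \o f_ n) x) =
      (fun n => (\sum_(0 <= k < n) c k * Y x ^+ k) * u x).
    apply/funext => n; rewrite /f_ /= mulr_suml.
    by apply: eq_bigr => k _; rewrite mulrA.
  by apply: cvgMr_tmp; exact: cphi.
- exact: iG.
- apply: aeW => x n _; rewrite /= lee_fin; apply: le_trans (hG x).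
  rewrite /f_; under eq_bigr do rewrite mulrA.
  rewrite -mulr_suml normrM ler_wpM2r//.
  apply: le_trans (series_expR_le n (normr_ge0 (Y x))).
  apply: le_trans (ler_norm_sum _ _ _) _; apply: ler_sum => k _.
  by rewrite normrM normrX mulrC ler_wpM2l ?exprn_ge0.
move=> i1 _ L; split=> //.
have L0 : (fun n : nat => (\int[mu]_x (EFin \o f_ n) x)%E) @ \oo --> 0%E.
  apply: cvg_near_cst; apply: nearW => n; have [h1 h2] := if_ n.
  by rewrite -[LHS]fineK ?integrable_fin_num//= -[X in X%:E]/(Rintegral mu setT (f_ n)) h2.
rewrite /Rintegral.
by have := cvg_unique _ L L0 => /= ->.
Qed.

End entire_series.

Section nonvanishing.
Variable R : realType.
Local Notation leb := (@lebesgue_measure R).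
Local Notation C := R[i].
Local Notation RR := (measurableTypeR R * measurableTypeR R)%type.
Implicit Types (a b g : C) (p q : nat).

Lemma qform_moment2_eq0 (al be ka : R) a b g k p q : posdef_form a b g ->
  moment2 a b g 0 0 = 0 ->
  let h (z : RR) := (qform al be ka z.1 z.2 ^+ k)%:C * monomial2 a b g p q z in
  integrableC (lebesgue2 R) h /\ integralC (lebesgue2 R) h = 0.
Proof.
move=> pd m0; elim: k p q => [|k IHk] p q h.
  have -> : h = monomial2 a b g p q by apply/funext => z; rewrite /h expr0 mul1r.
  by split; [exact: integrableC_monomial2 | exact: moment2_eq0].
have [i1 e1] := IHk p.+2 q; have [i2 e2] := IHk p q.+2.
have [i3 e3] := IHk p.+1 q.+1.
set h1 := (fun z => _) in i1 e1; set h2 := (fun z => _) in i2 e2.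
set h3 := (fun z => _) in i3 e3.
have -> : h = (fun z => (al / 2)%:C * h1 z +
    ((be / 2)%:C * h2 z + ka%:C * h3 z)).
  apply/funext => z; rewrite /h /h1 /h2 /h3 /monomial2 exprS {1}/qform.
  rewrite !(rmorphM, rmorphD, rmorphXn) /= !exprS; ring.
have j1 := integrableC_Z (al / 2)%:C i1.
have j2 := integrableC_Z (be / 2)%:C i2.
have j3 := integrableC_Z ka%:C i3.
have j23 := integrableC_D j2 j3.
split; first exact: integrableC_D.
by rewrite !integralC_D// !integralC_Z// e1 e2 e3 !mulr0 !addr0.
Qed.

Lemma cvg_cos_series (t : R) :
  (fun n => \sum_(0 <= k < n) ((~~ odd k)%:R * (-1) ^+ k./2 / k`!%:R) * t ^+ k)
  @ \oo --> cos t.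
Proof.
rewrite cos.unlock.
have -> : (fun n => \sum_(0 <= k < n) ((~~ odd k)%:R * (-1) ^+ k./2 / k`!%:R) * t ^+ k)
    = series (cos_coeff t).
  by apply/funext => n; rewrite /series /= cos_coeffE; apply: eq_bigr => k _; ring.
exact: is_cvg_series_cos_coeff.
Qed.

Lemma cvg_sin_series (t : R) :
  (fun n => \sum_(0 <= k < n) ((odd k)%:R * (-1) ^+ k.-1./2 / k`!%:R) * t ^+ k)
  @ \oo --> sin t.
Proof.
rewrite sin.unlock.
have -> : (fun n => \sum_(0 <= k < n) ((odd k)%:R * (-1) ^+ k.-1./2 / k`!%:R) * t ^+ k)
    = series (sin_coeff t).
  by apply/funext => n; rewrite /series /= sin_coeffE; apply: eq_bigr => k _; ring.
exact: is_cvg_series_sin_coeff.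
Qed.

Let coeff_bound (e : bool) m k : `|e%:R * (-1) ^+ m / k`!%:R| <= (k`!%:R : R)^-1.
Proof.
rewrite normrM normrM normrX normrN1 expr1n mulr1 ger0_norm ?ler0n//.
rewrite ger0_norm ?invr_ge0 ?ler0n// ler_piMl ?invr_ge0 ?ler0n//.
by case: e.
Qed.

(** Changing the imaginary parts multiplies the weight by [exp(- i Y)], where [Y] is the form of the
    increments. The bound [e / 2] on [Y] leaves [exp |Y|] times the modulus of the weight below a
    Gaussian of rate [e / 2], so [cos Y] and [sin Y] can be expanded under the integral. The real
    parts do not change, so the step can be repeated with the same [e]. *)
Lemma moment2_step (e al be ka : R) a b g : 0 < e ->
  (forall x y, e * (x ^+ 2 + y ^+ 2) <=
    qform (complex.Re a) (complex.Re b) (complex.Re g) x y) ->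
  (forall x y, `|qform al be ka x y| <= e / 2 * (x ^+ 2 + y ^+ 2)) ->
  moment2 a b g 0 0 = 0 ->
  moment2 (a + (0 +i* al)) (b + (0 +i* be)) (g + (0 +i* ka)) 0 0 = 0.
Proof.
move=> e0 pde hY m0; have pd : posdef_form a b g by exists e.
pose Y (z : RR) := qform al be ka z.1 z.2.
have e20 : 0 < e / 2 by rewrite divr_gt0.
have iG := integrable_prodM (integrable_gauss e20) (integrable_gauss e20).
set G := (fun z => _) in iG.
have hG t : unit_bounded t -> forall z : RR,
    expR `|Y z| * `|gauss_term t a b g 0 0 z.1 z.2| <= G z.
  move=> [_ t1] z; rewrite /G /gauss_term !expr0 !mul1r normrM (ger0_norm (expR_ge0 _)).
  apply: (@le_trans _ _ (expR `|Y z| *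
    expR (- qform (complex.Re a) (complex.Re b) (complex.Re g) z.1 z.2))).
    by rewrite ler_wpM2l ?expR_ge0// ler_piMr ?expR_ge0.
  rewrite -!expRD ler_expR; have := pde z.1 z.2; have := hY z.1 z.2.
  rewrite -/(Y z); lra.
have hYk t : unit_bounded t -> (t = cos \/ t = sin) -> forall k,
    (lebesgue2 R).-integrable setT
      (EFin \o (fun z : RR => Y z ^+ k * gauss_term t a b g 0 0 z.1 z.2)) /\
    Rintegral (lebesgue2 R) setT (fun z => Y z ^+ k * gauss_term t a b g 0 0 z.1 z.2) = 0.
  move=> _ ht k; have [[i1 i2] [e1 e2]] := qform_moment2_eq0 al be ka k 0 0 pd m0.
  case: ht => ->.
    have E : (fun z : RR => Y z ^+ k * gauss_term cos a b g 0 0 z.1 z.2) =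
        (fun z => complex.Re ((qform al be ka z.1 z.2 ^+ k)%:C * monomial2 a b g 0 0 z)).
      by apply/funext => z; rewrite monomial2E ReM /= mul0r subr0.
    by rewrite E.
  have E : (fun z : RR => Y z ^+ k * gauss_term sin a b g 0 0 z.1 z.2) =
      (fun z => complex.Im ((qform al be ka z.1 z.2 ^+ k)%:C * monomial2 a b g 0 0 z)).
    by apply/funext => z; rewrite monomial2E ImM /= mul0r addr0.
  by rewrite E.
have mY : measurable_fun setT Y.
  have := measurableT_comp (@oppr_measurable R setT) (measurable_qf al be ka).
  by apply: eq_measurable_fun => z _; rewrite /= opprK.
have I phi t : unit_bounded phi -> (phi = cos \/ phi = sin) ->
    unit_bounded t -> (t = cos \/ t = sin) ->
    (lebesgue2 R).-integrable setT
      (EFin \o (fun z : RR => phi (Y z) * gauss_term t a b g 0 0 z.1 z.2)) /\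
    Rintegral (lebesgue2 R) setT (fun z => phi (Y z) * gauss_term t a b g 0 0 z.1 z.2) = 0.
  move=> tphi hphi tt ht.
  have mp : measurable_fun setT (fun z : RR => phi (Y z) * gauss_term t a b g 0 0 z.1 z.2).
    apply: measurable_funM; last exact: measurable_gauss_term.
    apply: measurableT_comp mY; apply: continuous_measurable_fun.
    by case: tphi.
  case: hphi mp => -> mp.
    exact: (integral_entire_eq0 cvg_cos_series (fun k => coeff_bound _ _ k)
      (hYk t tt ht) iG (hG t tt) mp).
  exact: (integral_entire_eq0 cvg_sin_series (fun k => coeff_bound _ _ k)
    (hYk t tt ht) iG (hG t tt) mp).
have tc := unit_bounded_cos R; have ts := unit_bounded_sin R.
have [cc1 cc2] := I cos cos tc (or_introl erefl) tc (or_introl erefl).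
have [cs1 cs2] := I cos sin tc (or_introl erefl) ts (or_intror erefl).
have [sc1 sc2] := I sin cos ts (or_intror erefl) tc (or_introl erefl).
have [ss1 ss2] := I sin sin ts (or_intror erefl) ts (or_intror erefl).
have qfD (x y : R) : qform (complex.Im (a + (0 +i* al))) (complex.Im (b + (0 +i* be)))
    (complex.Im (g + (0 +i* ka))) x y =
    qform (complex.Im a) (complex.Im b) (complex.Im g) x y + qform al be ka x y.
  by rewrite !ImD /qform /=; ring.
have qfD' (x y : R) : qform (complex.Re (a + (0 +i* al))) (complex.Re (b + (0 +i* be)))
    (complex.Re (g + (0 +i* ka))) x y =
    qform (complex.Re a) (complex.Re b) (complex.Re g) x y.
  by rewrite !ReD /= !addr0.
apply: complex_ext.
  change (Rintegral (lebesgue2 R) setT (fun z => complex.Re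
    (monomial2 (a + (0 +i* al)) (b + (0 +i* be)) (g + (0 +i* ka)) 0 0 z)) = 0).
  transitivity (Rintegral (lebesgue2 R) setT (fun z =>
      cos (Y z) * gauss_term cos a b g 0 0 z.1 z.2 +
      sin (Y z) * gauss_term sin a b g 0 0 z.1 z.2)); last first.
    by rewrite RintegralD// cc2 ss2 addr0.
  apply: eq_Rintegral => z _; rewrite monomial2E /= /gauss_term qfD qfD' !expr0 -/(Y z).
  by rewrite (opprD _ (Y z)) cosD (cosN (Y z)) (sinN (Y z)); ring.
change (Rintegral (lebesgue2 R) setT (fun z => complex.Im
  (monomial2 (a + (0 +i* al)) (b + (0 +i* be)) (g + (0 +i* ka)) 0 0 z)) = 0).
transitivity (Rintegral (lebesgue2 R) setT (fun z =>
    cos (Y z) * gauss_term sin a b g 0 0 z.1 z.2 -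
    sin (Y z) * gauss_term cos a b g 0 0 z.1 z.2)); last first.
  by rewrite RintegralB// cs2 sc2 subr0.
apply: eq_Rintegral => z _; rewrite monomial2E /= /gauss_term qfD qfD' !expr0 -/(Y z).
by rewrite (opprD _ (Y z)) sinD (cosN (Y z)) (sinN (Y z)); ring.
Qed.

Lemma lebesgue2T : lebesgue2 R setT = +oo%E.
Proof.
have lebT : leb setT = +oo%E.
  by rewrite -set_itvNyy lebesgue_measure_itv.
rewrite -setXTT /lebesgue2 /= /prod_sfm product_measure1E//=.
by rewrite [X in (X * _)%E]lebT [X in (_ * X)%E]lebT mulyy.
Qed.

Lemma moment2_real_neq0 a b g : posdef_form a b g ->
  complex.Im a = 0 -> complex.Im b = 0 -> complex.Im g = 0 ->
  moment2 a b g 0 0 != 0.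
Proof.
move=> pd a0 b0 g0; apply/eqP => m0.
pose f (z : RR) : R :=
  expR (- qform (complex.Re a) (complex.Re b) (complex.Re g) z.1 z.2).
have fE : f = (fun z => gauss_term cos a b g 0 0 z.1 z.2).
  apply/funext => z; rewrite /f /gauss_term a0 b0 g0 !expr0 !mul1r.
  by rewrite /qform !mul0r !addr0 oppr0 cos0 mulr1.
have if_ : (lebesgue2 R).-integrable setT (EFin \o f).
  by rewrite fE; exact: integrable_gauss_term (unit_bounded_cos R) pd.
have f0 : (\int[lebesgue2 R]_z `|(EFin \o f) z|)%E = 0%E.
  under eq_integral do rewrite /= ger0_norm ?expR_ge0//.
  rewrite -[LHS]fineK ?(integrable_fin_num _ if_)//.
  congr EFin; rewrite -[LHS]/(Rintegral (lebesgue2 R) setT f) fE.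
  rewrite -[RHS]/(complex.Re (0 : C)) -m0.
  by apply: eq_Rintegral => z _; rewrite monomial2E.
(* A function with zero absolute integral vanishes almost everywhere; as [f] is positive everywhere,
   the plane would be a null set. *)
have /(ae_eq_integral_abs _ measurableT (measurable_int _ if_)) := f0.
move=> [N [mN N0 sN]].
have NT : N = setT.
  apply/seteqP; split=> // z _; apply: sN => /= /(_ I) /eqP.
  by rewrite eqe gt_eqF ?expR_gt0.
by have := lebesgue2T; rewrite -NT N0.
Qed.

Lemma moment2_neq0 a b g : posdef_form a b g -> moment2 a b g 0 0 != 0.
Proof.
move=> [e e0 pde]; apply/eqP => m0.
pose al := complex.Im a; pose be := complex.Im b; pose ka := complex.Im g.
pose K := `|al| + `|be| + `|ka|.
have K0 : 0 <= K by rewrite !addr_ge0.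
have hK (x y : R) : `|qform al be ka x y| <= K * (x ^+ 2 + y ^+ 2).
  have xy : `|x * y| <= x ^+ 2 + y ^+ 2.
    have h1 := sqr_ge0 (x + y); have h2 := sqr_ge0 (x - y).
    have h3 := sqr_ge0 x; have h4 := sqr_ge0 y.
    by rewrite ler_norml; apply/andP; split; nra.
  have x2 := sqr_ge0 x; have y2 := sqr_ge0 y.
  rewrite /qform; apply: le_trans (ler_normD _ _) _.
  rewrite /K mulrDl; apply: lerD; last by rewrite normrM ler_wpM2l.
  apply: le_trans (ler_normD _ _) _; rewrite mulrDl.
  have H (c u s : R) : 0 <= u -> u <= s -> `|c / 2 * u| <= `|c| * s.
    move=> u0 us; rewrite normrM (ger0_norm u0) normrM -mulrA ler_wpM2l//.
    by rewrite ger0_norm ?invr_ge0//; lra.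
  by apply: lerD; apply: H => //; rewrite ?lerDl ?lerDr.
(* The form of the imaginary parts is at most [K (x^2 + y^2)]; [m] is the number of equal steps that
   keeps each of them within the bound [e / 2]. *)
pose m := (Num.bound (2 * K / e)).+1.
have m0' : (0 : R) < m%:R by rewrite ltr0n.
have Km : K / m%:R <= e / 2.
  have : 2 * K / e <= m%:R.
    apply: le_trans (ltW (archi_boundP _)) _; last by rewrite ler_nat leqnSn.
    by rewrite divr_ge0 ?mulr_ge0// ltW.
  by rewrite ler_pdivrMr// => h; rewrite ler_pdivrMr//; lra.
(* A straight path from the given parameters, at [j = 0], to their real parts, at [j = m]. *)
pose A j : C := a - (0 +i* (j%:R * (al / m%:R))).
pose B j : C := b - (0 +i* (j%:R * (be / m%:R))).
pose G j : C := g - (0 +i* (j%:R * (ka / m%:R))).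
have step (z : C) (r : R) (j : nat) : z - (0 +i* (j.+1%:R * r)) =
    z - (0 +i* (j%:R * r)) + (0 +i* (- r)).
  by case: z => zr zi; apply: complex_ext; rewrite /= -?natr1; ring.
have Re_ (z : C) (r : R) : complex.Re (z - (0 +i* r)) = complex.Re z.
  by case: z => zr zi /=; rewrite oppr0 addr0.
have H j : moment2 (A j) (B j) (G j) 0 0 = 0.
  elim: j => [|j IHj].
    rewrite /A /B /G !mul0r.
    have -> : (0 +i* 0 : C) = 0 by [].
    by rewrite !subr0.
  rewrite /A /B /G !step; apply: (moment2_step e0) IHj.
    by move=> x y; rewrite !Re_; exact: pde.
  move=> x y.
  have -> : qform (- (al / m%:R)) (- (be / m%:R)) (- (ka / m%:R)) x y =
      - (qform al be ka x y / m%:R).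
    by rewrite /qform; field; rewrite gt_eqF.
  rewrite normrN normrM [X in _ * X]ger0_norm ?invr_ge0 ?ler0n//.
  rewrite ler_pdivrMr//; apply: le_trans (hK _ _) _.
  rewrite mulrAC ler_wpM2r ?addr_ge0 ?sqr_ge0//.
  by rewrite -ler_pdivrMr.
have := @moment2_real_neq0 (A m) (B m) (G m).
have Im0 (z : C) : complex.Im (z - (0 +i* (m%:R * (complex.Im z / m%:R)))) = 0.
  by case: z => zr zi /=; field; rewrite gt_eqF.
rewrite !Im0 H eqxx => h; suff : false by [].
by apply: h => //; exists e => // x y; rewrite !Re_; exact: pde.
Qed.

End nonvanishing.

(** * The Gaussian weight on pairs of Hermitian matrices *)

Section cexp.
Variable R : realType.
Implicit Types z w : R[i].

Lemma cexpD z w : cexp (z + w) = cexp z * cexp w.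
Proof.
rewrite /cexp ReD ImD expRD cosD sinD.
by apply: complex_ext; rewrite ?ReM ?ImM /=; ring.
Qed.

Lemma cexp0 : cexp (0 : R[i]) = 1.
Proof. by rewrite /cexp /= expR0 cos0 sin0 mul1r. Qed.

Lemma cexp_sum I (r : seq I) (F : I -> R[i]) :
  cexp (\sum_(i <- r) F i) = \prod_(i <- r) cexp (F i).
Proof.
by elim: r => [|i r IHr]; rewrite ?(big_nil, big_cons) ?cexp0// cexpD IHr.
Qed.

(** Transfers integrability of the two real components of a weight to its modulus:
    [|cos| + |sin| >= cos^2 + sin^2 = 1]. *)
Lemma expR_Re_le_cexp z :
  expR (complex.Re z) <= `|complex.Re (cexp z)| + `|complex.Im (cexp z)|.
Proof.
rewrite /cexp ReM ImM /= !mul0r subr0 addr0 !normrM (ger0_norm (expR_ge0 _)).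
rewrite -mulrDr ler_peMr ?expR_ge0// -(cos2Dsin2 (complex.Im z)).
set c := cos _; set s := sin _.
have hc : `|c| <= 1 by rewrite ler_norml cos_geN1 cos_le1.
have hs : `|s| <= 1 by rewrite ler_norml sin_geN1 sin_le1.
by rewrite -(real_normK (num_real c)) -(real_normK (num_real s));
  apply: lerD; rewrite expr2 ler_piMr.
Qed.

Lemma weight2E (a b g : R[i]) (z : measurableTypeR R * measurableTypeR R) : weight2 a b g z =
  cexp (- (a / 2%:R * (z.1 ^+ 2)%:C + b / 2%:R * (z.2 ^+ 2)%:C + g * (z.1 * z.2)%:C)).
Proof.
rewrite /weight2; congr cexp.
have -> : (2%:R : R[i])^-1 = (2^-1)%:C by rewrite fmorphV rmorph_nat.
apply: complex_ext; rewrite ?ReN ?ImN !(ReD, ImD, ReM, ImM) /qform /=; ring.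
Qed.

End cexp.

Section weight.
Variables (R : realType) (n : nat).
Local Notation C := R[i].
Local Notation coords := ((n * n).-tuple (measurableTypeR R)).

(** Multiplicity of a real coordinate in the trace of a product of Hermitian matrices: off the
    diagonal it contributes through the entry and through its transpose. *)
Definition entry_weight (k : 'I_(n * n)) : R :=
  (mxvec (\matrix_(i < n, j < n) if i == j then 1 else 2 : R)) 0 k.

Lemma entry_weightE i j : entry_weight (mxvec_index i j) = if i == j then 1 else 2.
Proof. by rewrite /entry_weight mxvecE mxE. Qed.

Lemma sum_mxvec (F : 'I_(n * n) -> C) :
  \sum_k F k = \sum_i \sum_j F (mxvec_index i j).
Proof.
rewrite pair_bigA (reindex _ (curry_mxvec_bij _ _)) /=.
by apply: eq_bigr => -[i j].
Qed.

Lemma entry_weight_gt0 k : 0 < entry_weight k.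
Proof. by case/mxvec_indexP: k => i j; rewrite entry_weightE; case: ifP. Qed.

Lemma trace_herm_mx (s t : coords) :
  \tr (herm_mx s * herm_mx t) =
  \sum_k (entry_weight k * (tnth s k * tnth t k))%:C.
Proof.
pose S i j : C := (entry_weight (mxvec_index i j) *
  (tnth s (mxvec_index i j) * tnth t (mxvec_index i j)))%:C.
pose U i j : C := herm_mx s i j * herm_mx t j i.
rewrite sum_mxvec.
have -> : \tr (herm_mx s * herm_mx t) = \sum_i \sum_j U i j.
  by apply: eq_bigr => i _; rewrite mxE.
rewrite -/(\sum_i \sum_j S i j).
(* The two double sums do not agree term by term: [U i j] mixes real and imaginary parts, [S i j]
   contains only one of them. They agree after symmetrisation in [i] and [j], whence the comparison
   of their doubles. *)
have E i j : U i j + U j i = S i j + S j i.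
  rewrite /U /S !entry_weightE !mxE [j == i]eq_sym; have [->|ij] := eqVneq i j.
    by apply: complex_ext; rewrite /=; ring.
  case: ltngtP => [lt_ij|lt_ij|/val_inj /eqP]; last by rewrite (negPf ij).
    by apply: complex_ext; rewrite /=; ring.
  by apply: complex_ext; rewrite /=; ring.
have : (\sum_i \sum_j U i j) *+ 2 = (\sum_i \sum_j S i j) *+ 2.
  have D (V : 'I_n -> 'I_n -> C) : (\sum_i \sum_j V i j) *+ 2 =
      \sum_i \sum_j (V i j + V j i).
    under [RHS]eq_bigr do rewrite big_split.
    by rewrite big_split /= [X in _ = _ + X]exchange_big.
  by rewrite !D; apply: eq_bigr => i _; apply: eq_bigr => j _; exact: E.
move=> H; apply: (@mulIf _ (2%:R : C)); first by rewrite pnatr_eq0.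
by rewrite [LHS]mulr_natr [RHS]mulr_natr.
Qed.

Definition gexp (a1 a2 g : C) (x : coords * coords) : C :=
  - \tr ((a1 / 2%:R) *: herm_mx x.1 ^+ 2 + (a2 / 2%:R) *: herm_mx x.2 ^+ 2 +
         g *: (herm_mx x.1 * herm_mx x.2)).

Lemma gexpE a1 a2 g x : gexp a1 a2 g x = \sum_k
  - (a1 / 2%:R * (entry_weight k * tnth x.1 k ^+ 2)%:C
     + a2 / 2%:R * (entry_weight k * tnth x.2 k ^+ 2)%:C
     + g * (entry_weight k * (tnth x.1 k * tnth x.2 k))%:C).
Proof.
rewrite sumrN !big_split /= -!mulr_sumr /gexp; congr (- _).
rewrite !mxtraceD !mxtraceZ expr2 trace_herm_mx [_ ^+ 2]expr2 !trace_herm_mx.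
by do 2 congr (_ + _); congr (_ * _); apply: eq_bigr => k _; rewrite expr2.
Qed.

Lemma weight_prod a1 a2 g x :
  gauss_weight a1 a2 g (herm_mx x.1) (herm_mx x.2) =
  \prod_k weight2 ((entry_weight k)%:C * a1) ((entry_weight k)%:C * a2) ((entry_weight k)%:C * g)
    (tnth x.1 k, tnth x.2 k).
Proof.
rewrite -[LHS]/(cexp (gexp a1 a2 g x)) gexpE cexp_sum.
by apply: eq_bigr => k _; rewrite weight2E /= !rmorphM /=; congr cexp; ring.
Qed.

Definition pos_def (a1 a2 g : C) : Prop :=
  [/\ 0 < complex.Re a1, 0 < complex.Re a2 &
      complex.Re g ^+ 2 < complex.Re a1 * complex.Re a2].

Lemma pos_def_form a1 a2 g k : pos_def a1 a2 g ->
  posdef_form ((entry_weight k)%:C * a1) ((entry_weight k)%:C * a2) ((entry_weight k)%:C * g).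
Proof.
case: a1 a2 g => [a ai] [b bi] [c ci] [/= a0 b0 c0].
have k0 := entry_weight_gt0 k; have tr0 : 0 < 2 * (a + b) by rewrite mulr_gt0// addr_gt0.
(* For the symmetric matrix [M] of the real form, Cayley-Hamilton gives
   [|M v|^2 = tr M <v, M v> - det M |v|^2], so [det M / tr M] bounds [<v, M v> / |v|^2] from below;
   the factor 2 is that of the halves in [qform]. *)
exists (entry_weight k * ((a * b - c ^+ 2) / (2 * (a + b)))).
  by rewrite mulr_gt0// divr_gt0// subr_gt0.
move=> x y; rewrite !ReM /= !mul0r !subr0 -subr_ge0.
have -> : qform (entry_weight k * a) (entry_weight k * b) (entry_weight k * c) x y -
    entry_weight k * ((a * b - c ^+ 2) / (2 * (a + b))) * (x ^+ 2 + y ^+ 2) =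
    entry_weight k * (((a * x + c * y) ^+ 2 + (c * x + b * y) ^+ 2) / (2 * (a + b))).
  by rewrite /qform; field; rewrite gt_eqF ?addr_gt0.
by rewrite mulr_ge0 ?(ltW k0)// divr_ge0 ?addr_ge0 ?sqr_ge0// ltW.
Qed.

Lemma pos_def_delta a1 a2 g : (0 < n)%N -> pos_def a1 a2 g -> delta a1 a2 g != 0.
Proof.
move=> n0 pd; pose i0 := Ordinal n0.
have := posdef_form_det (pos_def_form (mxvec_index i0 i0) pd).
by rewrite entry_weightE eqxx !mul1r.
Qed.

End weight.

(** * The domain of absolute convergence *)

Section non_integrable.
Context d (T : measurableType d) (R : realType).
Variable mu : {sigma_finite_measure set T -> \bar R}.

Lemma not_integrable_prod (h : T -> R) : mu setT = +oo%E -> (forall t, 0 < h t) ->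
  measurable_fun setT h ->
  ~ (mu \x mu)%E.-integrable setT (EFin \o (fun z => h z.1)) /\
  ~ (mu \x mu)%E.-integrable setT (EFin \o (fun z => h z.2)).
Proof.
move=> muT h0 mh.
have c0 : (0 < \int[mu]_t `|(EFin \o h) t|)%E.
  rewrite lt0e integral_ge0// andbT; apply/eqP.
  have mh' : measurable_fun setT (EFin \o h) by exact/measurable_EFinP.
  move=> /(ae_eq_integral_abs _ measurableT mh') [N [mN N0 sN]].
  have NT : N = setT.
    apply/seteqP; split=> // t _; apply: sN => /= /(_ I) /eqP.
    by rewrite eqe gt_eqF.
  by have := muT; rewrite -NT N0.
have I : (\int[mu]_s (\int[mu]_t `|(EFin \o h) t|) = +oo)%E.
  rewrite -[LHS]/(\int[mu]_s (cst (\int[mu]_t `|(EFin \o h) t|) s))%E.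
  by rewrite integral_cst// [X in (_ * X)%E]muT gt0_muley.
have m1 : measurable_fun setT (EFin \o (fun z : T * T => h z.1)).
  by apply/measurable_EFinP; exact: measurableT_comp mh measurable_fst.
have m2 : measurable_fun setT (EFin \o (fun z : T * T => h z.2)).
  by apply/measurable_EFinP; exact: measurableT_comp mh measurable_snd.
split.
  by move=> /(proj1 (integrable21ltyP mu mu m1)); rewrite [X in (X < _)%E]I ltxx.
by move=> /(proj1 (integrable12ltyP mu mu m2)); rewrite [X in (X < _)%E]I ltxx.
Qed.

End non_integrable.

Section domain.
Variables (R : realType) (n : nat).
Local Notation C := R[i].
Local Notation leb := (@lebesgue_measure R).
Local Notation coords := ((n * n).-tuple (measurableTypeR R)).

Lemma tuple_lebesgueT N : (0 < N)%N -> tuple_measure leb N setT = +oo%E.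
Proof.
case: N => // N _.
have := @tuple_measure_box _ _ _ leb N.+1 (fun=> setT) (fun=> measurableT).
rewrite (_ : [set t | _] = setT); last by apply/seteqP; split.
move=> ->; have lebT : leb setT = +oo%E.
  by rewrite -set_itvNyy lebesgue_measure_itv.
elim: N => [|N IHN]; first by rewrite big_ord1.
by rewrite big_ord_recl IHN [X in (X * _)%E]lebT mulyy.
Qed.

(** The variable [u] stands for [exp phi]. A negative [a] is excluded by a large [u]; if [a = 0],
    then [u = 1] gives [b > 0], and a nonzero [c] is excluded by [u = b / |c|], where the right-hand
    side is only [|c|]. *)
Let half_domain (a b c : R) : (forall u, 0 < u -> 2 * `|c| < a * u + b / u) ->
  0 <= a /\ (a = 0 -> c = 0 /\ 0 < b).
Proof.
move=> H; split.
  rewrite leNgt; apply/negP => a0.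
  (* Chosen so that [a u = a - |b|] and [u >= 1]; then [(a u + b / u) u <= a - |b| + b < 0]. *)
  pose u := 1 + `|b| / - a.
  have na0 : 0 < - a by rewrite oppr_gt0.
  have v0 : 0 <= `|b| / - a by rewrite divr_ge0// ltW.
  have u1 : 1 <= u by rewrite lerDl.
  have u0 : 0 < u by apply: lt_le_trans u1.
  have := H _ u0; rewrite -(ltr_pM2r u0).
  have -> : (a * u + b / u) * u = a * u * u + b by field; rewrite gt_eqF.
  have uE : a * u = a - `|b|.
    by rewrite /u mulrDr mulr1; congr (_ + _); field; rewrite lt_eqF.
  have h1 : a * u * u <= a * u.
    rewrite uE; have nb := normr_ge0 b.
    have : 0 <= (`|b| - a) * (u - 1) by apply: mulr_ge0; lra.
    by rewrite mulrBr mulr1 [(_ - _) * u]mulrBl [(a - _) * u]mulrBl; lra.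
  have h2 : 0 <= 2 * `|c| * u by rewrite !mulr_ge0// ltW.
  have := ler_norm b; move: h1; rewrite uE => h1 hb h3; lra.
move=> a0; subst a.
have b0 : 0 < b.
  by have := H 1 ltr01; rewrite mul0r add0r divr1; apply: le_lt_trans; rewrite mulr_ge0.
split=> //; apply/eqP; apply: contraT => c0.
have c0' : 0 < `|c| by rewrite normr_gt0.
have := H (b / `|c|); rewrite divr_gt0// => /(_ erefl).
have -> : 0 * (b / `|c|) + b / (b / `|c|) = `|c| by field; rewrite !gt_eqF.
lra.
Qed.

Let qsum (r1 r2 r3 : R) (s t : coords) : R :=
  \sum_k - (r1 / 2 * (entry_weight R k * tnth s k ^+ 2)
     + r2 / 2 * (entry_weight R k * tnth t k ^+ 2)
     + r3 * (entry_weight R k * (tnth s k * tnth t k))).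

Let measurable_qsum d (T : measurableType d) (s t : T -> coords) r1 r2 r3 :
  measurable_fun setT s -> measurable_fun setT t ->
  measurable_fun setT (fun x => expR (qsum r1 r2 r3 (s x) (t x))).
Proof.
move=> ms mt; apply: measurableT_comp => //; apply: measurable_sum => k.
apply: (measurableT_comp (@oppr_measurable R setT)).
have m1 : measurable_fun setT (fun x => tnth (s x) k).
  exact: (measurableT_comp (measurable_tnth k) ms).
have m2 : measurable_fun setT (fun x => tnth (t x) k).
  exact: (measurableT_comp (measurable_tnth k) mt).
apply: measurable_funD; first apply: measurable_funD.
- by do 2 apply: measurable_funM => //; exact: measurable_funX.
- by do 2 apply: measurable_funM => //; exact: measurable_funX.
- by do 2 apply: measurable_funM => //; exact: measurable_funM.
Qed.

Let Re_gexp a1 a2 g (x : coords * coords) : complex.Re (gexp a1 a2 g x) =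
  qsum (complex.Re a1) (complex.Re a2) (complex.Re g) x.1 x.2.
Proof.
have Re0 : complex.Re (0 : C) = 0 by [].
rewrite gexpE (big_morph (@complex.Re R) (@ReD R) Re0).
apply: eq_bigr => k _.
have -> : (2%:R : C)^-1 = (2^-1)%:C by rewrite fmorphV rmorph_nat.
by rewrite !(ReN, ReD, ReM, ImM) /=; ring.
Qed.

Let domain_ineq a1 a2 g :
  (forall phi : R,
    0 < complex.Re (a1 * (expR phi)%:C + a2 * (expR (- phi))%:C + 2%:R * g) /\
    0 < complex.Re (a1 * (expR phi)%:C + a2 * (expR (- phi))%:C - 2%:R * g)) ->
  forall u, 0 < u ->
    2 * `|complex.Re g| < complex.Re a1 * u + complex.Re a2 / u.
Proof.
move=> H u u0; have := H (ln u).
rewrite expRN lnK ?posrE// mulr_natl mulr2n !(ReN, ReD, ReM) /= !mulr0 !subr0.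
move=> [h1 h2]; suff : `|2 * complex.Re g| < complex.Re a1 * u + complex.Re a2 / u.
  by rewrite normrM (ger0_norm (ler0n _ 2)).
by rewrite ltr_norml; apply/andP; split; lra.
Qed.

Lemma gauss_domain_pos_def (F : 'M[C]_n -> 'M[C]_n -> C) a1 a2 g : (0 < n)%N ->
  gauss_domain F a1 a2 g -> pos_def a1 a2 g.
Proof.
move=> n0 [/domain_ineq ineq [iw1 iw2] _].
pose mu := tuple_measure leb (n * n).
have muT : mu setT = +oo%E by apply: tuple_lebesgueT; rewrite muln_gt0 n0.
have ih : (mu \x mu)%E.-integrable
    setT (EFin \o (fun x => expR (complex.Re (gexp a1 a2 g x)))).
  have iW : (mu \x mu)%E.-integrable
    setT (EFin \o (fun x => `|complex.Re (gauss_integrand (fun _ _ => 1) a1 a2 g x)|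
      + `|complex.Im (gauss_integrand (fun _ _ => 1) a1 a2 g x)|)).
    exact: (integrableD measurableT (integrable_norm iw1) (integrable_norm iw2)).
  apply: le_integrable iW => //.
    apply/measurable_EFinP; under eq_fun do rewrite Re_gexp.
    exact: measurable_qsum measurable_fst measurable_snd.
  move=> x _; rewrite /comp !abse_EFin lee_fin ger0_norm ?expR_ge0//.
  apply: le_trans (ler_norm _); rewrite /gauss_integrand !mul1r.
  exact: expR_Re_le_cexp.
have hpos r1 r2 r3 (t : coords) : 0 < expR (qsum r1 r2 r3 t t) by exact: expR_gt0.
have hm r1 r2 r3 : measurable_fun setT (fun t : coords => expR (qsum r1 r2 r3 t t)).
  exact: measurable_qsum (@measurable_id _ _ setT) (@measurable_id _ _ setT).
have [A0 hA] := half_domain ineq.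
have [B0 hB] : 0 <= complex.Re a2 /\
    (complex.Re a2 = 0 -> complex.Re g = 0 /\ 0 < complex.Re a1).
  apply: half_domain => u u0; have := ineq u^-1.
  by rewrite invr_gt0 invrK addrC; apply.
(* In each degenerate case the inequalities force [Re g = 0]; the modulus of the weight then depends
   on one matrix only and cannot be integrable over both. *)
have [E1|A1] := eqVneq (complex.Re a1) 0.
  have [g0 _] := hA E1.
  case: (not_integrable_prod muT (hpos 0 (complex.Re a2) 0) (hm _ _ _)) => _ [].
  apply: eq_integrable ih => // x _; rewrite /comp Re_gexp E1 g0.
  by congr (expR _)%:E; apply: eq_bigr => k _; ring.
have [E2|B1] := eqVneq (complex.Re a2) 0.
  have [g0 _] := hB E2.
  case: (not_integrable_prod muT (hpos (complex.Re a1) 0 0) (hm _ _ _)) => [+ _].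
  case; apply: eq_integrable ih => // x _; rewrite /comp Re_gexp E2 g0.
  by congr (expR _)%:E; apply: eq_bigr => k _; ring.
have {A0 A1 hA} A0 : 0 < complex.Re a1 by rewrite lt_def A1.
have {B0 B1 hB} B0 : 0 < complex.Re a2 by rewrite lt_def B1.
split=> //; pose s := Num.sqrt (complex.Re a1); pose t := Num.sqrt (complex.Re a2).
have s0 : 0 < s by rewrite sqrtr_gt0.
have t0 : 0 < t by rewrite sqrtr_gt0.
have sE : complex.Re a1 = s * s by rewrite -expr2 sqr_sqrtr// ltW.
have tE : complex.Re a2 = t * t by rewrite -expr2 sqr_sqrtr// ltW.
(* At [u = t / s] the expression [Re a1 u + Re a2 / u] attains its minimum [2 s t], so the
   inequality there is the strongest one. *)
have := ineq (t / s); rewrite divr_gt0// => /(_ erefl).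
have -> : complex.Re a1 * (t / s) + complex.Re a2 / (t / s) = 2 * (s * t).
  by rewrite sE tE; field; rewrite !gt_eqF.
rewrite ltr_pM2l// => lt_st.
rewrite sE tE mulrACA -expr2 -(real_normK (num_real (complex.Re g))).
by rewrite ltr_pXn2r// nnegrE// mulr_ge0// ltW.
Qed.

End domain.

(** * Polynomial functions of the coordinates and their derivatives *)

Section polynomial_functions.
Variables (R : realType) (N : nat).
Local Notation C := R[i].
Local Notation coords := (N.-tuple (measurableTypeR R)).
Local Notation X := (coords * coords)%type.
Implicit Types (F G : X -> C) (c b : bool) (k : 'I_N).

Definition coord c k (x : X) : C := (tnth (if c then x.1 else x.2) k)%:C.

(* [polyf m F]: the function [F] is a polynomial of degree at most [m] in the
   real coordinates. *)
Inductive polyf : nat -> (X -> C) -> Prop :=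
| polyf_cst a : polyf 0 (fun=> a)
| polyf_mul m c k F : polyf m F -> polyf m.+1 (fun x => coord c k x * F x)
| polyf_add m F G : polyf m F -> polyf m G -> polyf m (fun x => F x + G x)
| polyf_weak m F : polyf m F -> polyf m.+1 F.

(* [pder b v F F']: the function [F] is polynomial, and [F'] is its derivative
   along the vector [v] in the coordinates of the first ([b = true]) or second
   ([b = false]) matrix. *)
Inductive pder b (v : 'I_N -> C) : (X -> C) -> (X -> C) -> Prop :=
| pder_cst a : pder b v (fun=> a) (fun=> 0)
| pder_mul c k F F' : pder b v F F' -> pder b v (fun x => coord c k x * F x)
    (fun x => ((c == b)%:R * v k) * F x + coord c k x * F' x)
| pder_add F F' G G' : pder b v F F' -> pder b v G G' ->
    pder b v (fun x => F x + G x) (fun x => F' x + G' x).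

Lemma polyf_weaken m m' F : (m <= m')%N -> polyf m F -> polyf m' F.
Proof.
move=> /subnK <- pF; elim: (m' - m)%N => // j IHj.
by rewrite addSn; exact: polyf_weak.
Qed.

Lemma polyfZ m (a : C) F : polyf m F -> polyf m (fun x => a * F x).
Proof.
elim=> {m F} [a'|m c k F _ IH|m F G _ IHF _ IHG|m F _ IH].
- exact: polyf_cst.
- have -> : (fun x => a * (coord c k x * F x)) =
    (fun x => coord c k x * (a * F x)) by apply/funext => x; rewrite mulrCA.
  exact: polyf_mul.
- under eq_fun do rewrite mulrDr.
  exact: polyf_add.
- exact: polyf_weak.
Qed.

Lemma polyfM m m' F G : polyf m F -> polyf m' G ->
  polyf (m + m') (fun x => F x * G x).
Proof.
move=> + pG; elim=> {m F} [a|m c k F _ IH|m F F' _ IHF _ IHF'|m F _ IH].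
- exact: polyfZ.
- under eq_fun do rewrite -mulrA.
  exact: polyf_mul.
- under eq_fun do rewrite mulrDl.
  exact: polyf_add.
- exact: polyf_weak.
Qed.

Lemma pderZ b v a F F' : pder b v F F' ->
  pder b v (fun x => a * F x) (fun x => a * F' x).
Proof.
elim=> {F F'} [a'|c k F F' _ IH|F F' G G' _ IHF _ IHG].
- by under [X in pder _ _ _ X]eq_fun do rewrite mulr0; exact: pder_cst.
- have -> : (fun x => a * (coord c k x * F x)) =
    (fun x => coord c k x * (a * F x)) by apply/funext => x; rewrite mulrCA.
  have -> : (fun x => a * (((c == b)%:R * v k) * F x + coord c k x * F' x)) =
    (fun x => ((c == b)%:R * v k) * (a * F x) + coord c k x * (a * F' x)).
    by apply/funext => x; ring.
  exact: pder_mul.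
- have -> : (fun x => a * (F x + G x)) = (fun x => a * F x + a * G x).
    by apply/funext => x; ring.
  have -> : (fun x => a * (F' x + G' x)) = (fun x => a * F' x + a * G' x).
    by apply/funext => x; ring.
  exact: pder_add.
Qed.

Lemma pderM b v F F' G G' : pder b v F F' -> pder b v G G' ->
  pder b v (fun x => F x * G x) (fun x => F' x * G x + F x * G' x).
Proof.
move=> + pG; elim=> {F F'} [a|c k F F' _ IH|F F' H H' _ IHF _ IHH].
- have -> : (fun x => 0 * G x + a * G' x) = (fun x => a * G' x).
    by apply/funext => x; ring.
  exact: pderZ.
- have -> : (fun x => coord c k x * F x * G x) =
    (fun x => coord c k x * (F x * G x)) by apply/funext => x; ring.
  set d := (_%:R * v k).
  have -> : (fun x => (d * F x + coord c k x * F' x) * G x +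
      coord c k x * F x * G' x) =
    (fun x => d * (F x * G x) + coord c k x * (F' x * G x + F x * G' x)).
    by apply/funext => x; ring.
  exact: pder_mul.
- have -> : (fun x => (F x + H x) * G x) = (fun x => F x * G x + H x * G x).
    by apply/funext => x; ring.
  have -> : (fun x => (F' x + H' x) * G x + (F x + H x) * G' x) =
    (fun x => (F' x * G x + F x * G' x) + (H' x * G x + H x * G' x)).
    by apply/funext => x; ring.
  exact: pder_add.
Qed.

Lemma pder_sum b v I (r : seq I) (F F' : I -> X -> C) :
  (forall i, pder b v (F i) (F' i)) ->
  pder b v (fun x => \sum_(i <- r) F i x) (fun x => \sum_(i <- r) F' i x).
Proof.
move=> pF; elim: r => [|i r IHr].
  under eq_fun do rewrite big_nil.
  under [X in pder _ _ _ X]eq_fun do rewrite big_nil.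
  exact: pder_cst.
under eq_fun do rewrite big_cons.
under [X in pder _ _ _ X]eq_fun do rewrite big_cons.
exact: pder_add.
Qed.

(** The clause for [m = 0] serves the induction: for a coordinate times [F], the term
    [coord c k x * F' x] has degree [m.-1.+1], which exceeds [m] at [m = 0] unless [F'] vanishes. *)
Lemma pder_exists b v m F : polyf m F ->
  exists F', [/\ pder b v F F', polyf m.-1 F' & m = 0%N -> F' = fun=> 0].
Proof.
elim=> {m F} [a|m c k F pF [F' [dF pF' F'0]]|
    m F G _ [F' [dF pF' F'0]] _ [G' [dG pG' G'0]]|m F pF [F' [dF pF' F'0]]].
- by exists (fun=> 0); split=> //; [exact: pder_cst | exact: polyf_cst].
- eexists; split; [exact: pder_mul dF | | by []].
  apply: polyf_add; first exact: polyfZ.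
  case: m pF pF' F'0 => [|m] pF pF' F'0 /=; last exact: polyf_mul.
  rewrite F'0//; under eq_fun do rewrite mulr0.
  exact: polyf_cst.
- eexists; split; [exact: pder_add dF dG | exact: polyf_add |].
  by move=> m0; rewrite F'0// G'0//; apply/funext => x; rewrite addr0.
- exists F'; split=> //=; apply: polyf_weaken pF'; exact: leq_pred.
Qed.

Lemma polyf_pder b v F F' : pder b v F F' ->
  exists m, polyf m F /\ polyf m F'.
Proof.
elim=> {F F'} [a|c k F F' _ [m [pF pF']]|F F' G G' _ [m [pF pF']] _ [m' [pG pG']]].
- by exists 0%N; split; exact: polyf_cst.
- exists m.+1; split; first exact: polyf_mul.
  by apply: polyf_add; [apply: polyfZ; exact: polyf_weak | exact: polyf_mul].
- exists (maxn m m'); have h1 := leq_maxl m m'; have h2 := leq_maxr m m'.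
  by split; apply: polyf_add; (exact: polyf_weaken h1 _ || exact: polyf_weaken h2 _).
Qed.

(** Splits a derivation along a complex vector into the coordinate derivations, for which
    integration by parts is established. *)
Lemma pder_basis b v F F' : pder b v F F' ->
  exists2 D : 'I_N -> X -> C,
    (forall k, pder b (fun j => (j == k)%:R) F (D k)) &
    forall x, F' x = \sum_k v k * D k x.
Proof.
elim=> {F F'} [a|c j F F' _ [D pD DE]|F F' G G' _ [D pD DE] _ [D' pD' DE']].
- exists (fun _ _ => 0); first by move=> k; exact: pder_cst.
  by move=> x; rewrite big1// => k _; rewrite mulr0.
- exists (fun k x => ((c == b)%:R * (j == k)%:R) * F x + coord c j x * D k x).
    by move=> k; exact: pder_mul.
  move=> x; rewrite DE mulr_sumr.
  under [RHS]eq_bigr do rewrite mulrDr [_ * (coord _ _ _ * _)]mulrCA.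
  rewrite big_split /=; congr (_ + _).
  rewrite (bigD1 j)//= big1 => [|k kj]; last first.
    by rewrite [j == k]eq_sym (negPf kj) mulr0 mul0r mulr0.
  by rewrite addr0 eqxx mulr1 mulrCA mulrA.
- exists (fun k x => D k x + D' k x); first by move=> k; exact: pder_add.
  by move=> x; rewrite DE DE' -big_split; apply: eq_bigr => k _; rewrite mulrDr.
Qed.

Section monomials.
Implicit Types e : 'I_N -> nat * nat.

Definition monomialE e (x : X) : C :=
  \prod_j (tnth x.1 j ^+ (e j).1 * tnth x.2 j ^+ (e j).2)%:C.

Definition upd e k (pq : nat * nat) : 'I_N -> nat * nat :=
  fun j => if j == k then pq else e j.

Definition incE e c k := upd e k
  (if c then ((e k).1.+1, (e k).2) else ((e k).1, (e k).2.+1)).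

Definition decE e b k := upd e k
  (if b then ((e k).1.-1, (e k).2) else ((e k).1, (e k).2.-1)).

Definition degE e b k : nat := if b then (e k).1 else (e k).2.

Lemma upd_id e k : upd e k (e k) = e.
Proof. by apply/funext => j; rewrite /upd; case: eqP => // ->. Qed.

Lemma monomialE_upd e k pq x : monomialE (upd e k pq) x =
  (tnth x.1 k ^+ pq.1 * tnth x.2 k ^+ pq.2)%:C *
  \prod_(j | j != k) (tnth x.1 j ^+ (e j).1 * tnth x.2 j ^+ (e j).2)%:C.
Proof.
rewrite /monomialE (bigD1 k)//= /upd eqxx; congr (_ * _).
by apply: eq_bigr => j /negPf ->.
Qed.

Lemma coord_monomialE e c k p q x : coord c k x * monomialE (upd e k (p, q)) x =
  monomialE (upd e k (if c then (p.+1, q) else (p, q.+1))) x.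
Proof.
rewrite !monomialE_upd /coord mulrA -rmorphM; congr (_%:C * _).
by case: c => /=; rewrite exprS; ring.
Qed.

Lemma monomialE_inc e c k x : monomialE (incE e c k) x = coord c k x * monomialE e x.
Proof.
rewrite -{2}(upd_id e k) [in RHS](surjective_pairing (e k)) coord_monomialE.
by rewrite /incE; case: c.
Qed.

(** The product rule for a coordinate times a monomial, read on exponents. It is what allows
    coordinate factors to be moved into a monomial during integration by parts. *)
Lemma dmonomialE e c j b k x :
  (degE (incE e c j) b k)%:R * monomialE (decE (incE e c j) b k) x =
  ((c == b)%:R * (j == k)%:R) * monomialE e x +
  coord c j x * ((degE e b k)%:R * monomialE (decE e b k) x).
Proof.
have updupd k' pq pq' : upd (upd e k' pq) k' pq' = upd e k' pq'.
  by apply/funext => i; rewrite /upd; case: eqP.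
have updk e' k' pq : upd e' k' pq k' = pq by rewrite /upd eqxx.
have [<-|jk] := eqVneq j k; last first.
  have degk : degE (incE e c j) b k = degE e b k.
    by rewrite /degE /incE /upd eq_sym (negPf jk).
  rewrite degk mulr0 mul0r add0r mulrCA -monomialE_inc; congr (_ * monomialE _ _).
  apply/funext => i; rewrite /incE /decE /upd.
  have kj : (k == j) = false by rewrite eq_sym (negPf jk).
  rewrite kj (negPf jk).
  by case: (i =P k) => // ->; rewrite kj.
case E : (e j) => [p q].
have -> : monomialE e x = monomialE (upd e j (p, q)) x by rewrite -E upd_id.
rewrite mulr1 mulrCA /decE /degE /incE !updk E.
case: c; case: b; rewrite /= !updupd coord_monomialE ?mul0r ?add0r //.
- case: p {E} => [|p]; first by rewrite mul0r addr0.
  by rewrite -natr1 mulrDl addrC.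
- case: q {E} => [|q]; first by rewrite mul0r addr0.
  by rewrite -natr1 mulrDl addrC.
Qed.

End monomials.

End polynomial_functions.

(** * Integration by parts on pairs of Hermitian matrices *)

Section gaussian_moments.
Variables (R : realType) (n : nat) (a1 a2 g : R[i]).
Hypothesis pd : pos_def a1 a2 g.
Local Notation C := R[i].
Local Notation N := (n * n)%N.
Local Notation coords := (N.-tuple (measurableTypeR R)).
Local Notation X := (coords * coords)%type.
Implicit Types (F G H : X -> C) (c b : bool) (k : 'I_N).

Let mu : {sigma_finite_measure set coords -> \bar R} :=
  tuple_measure (@lebesgue_measure R) N.

Let mu2 : {sigma_finite_measure set X -> \bar R} := prod_sfm mu mu.

Let W (x : X) : C := gauss_weight a1 a2 g (herm_mx x.1) (herm_mx x.2).

Let kC k : C := (entry_weight R k)%:C.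

Let mk k (pq : nat * nat) : C :=
  moment2 (kC k * a1) (kC k * a2) (kC k * g) pq.1 pq.2.

Definition gauss_int H : C := integralC mu2 (fun x => H x * W x).

Definition gauss_integrable H : Prop := integrableC mu2 (fun x => H x * W x).

Let pdk k : posdef_form (kC k * a1) (kC k * a2) (kC k * g).
Proof. exact: pos_def_form. Qed.

Lemma gauss_integrable_D F G : gauss_integrable F -> gauss_integrable G -> gauss_integrable (fun x => F x + G x).
Proof.
move=> iF iG; have := integrableC_D iF iG.
by apply: eq_integrableC => x; rewrite mulrDl.
Qed.

Lemma gauss_integrable_Z a F : gauss_integrable F -> gauss_integrable (fun x => a * F x).
Proof.
move=> iF; have := integrableC_Z a iF.
by apply: eq_integrableC => x; rewrite mulrA.
Qed.

Lemma gauss_int_D F G : gauss_integrable F -> gauss_integrable G ->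
  gauss_int (fun x => F x + G x) = gauss_int F + gauss_int G.
Proof.
move=> iF iG; rewrite /gauss_int -integralC_D//.
by apply: eq_integralC => x; rewrite mulrDl.
Qed.

Lemma gauss_int_Z a F : gauss_integrable F -> gauss_int (fun x => a * F x) = a * gauss_int F.
Proof.
move=> iF; rewrite /gauss_int -integralC_Z//.
by apply: eq_integralC => x; rewrite mulrA.
Qed.

Lemma monomialE_weight e x : monomialE e x * W x =
  \prod_k monomial2 (kC k * a1) (kC k * a2) (kC k * g) (e k).1 (e k).2
    (tnth x.1 k, tnth x.2 k).
Proof. by rewrite /W weight_prod /monomialE -big_split. Qed.

Lemma gauss_int_monomialE e : gauss_integrable (monomialE e) /\ gauss_int (monomialE e) = \prod_k mk k (e k).
Proof.
have [i1 i2] := @integralC_tuple_prod _ (measurableTypeR R) R (@lebesgue_measure R) N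
  (fun k => monomial2 (kC k * a1) (kC k * a2) (kC k * g) (e k).1 (e k).2)
  (fun k => integrableC_monomial2 (e k).1 (e k).2 (pdk k)).
split.
  by apply: eq_integrableC i1 => x; rewrite monomialE_weight.
by rewrite /gauss_int -i2; apply: eq_integralC => x; rewrite monomialE_weight.
Qed.

(** The monomial is an accumulator: the induction transfers the coordinate factors of [F] to it
    until a constant is left. *)
Lemma polyf_gauss_integrable_mono m F e : polyf m F -> gauss_integrable (fun x => F x * monomialE e x).
Proof.
move=> pF; elim: pF e => {m F} [a|m c k F _ IH|m F G _ IHF _ IHG|m F _ IH] e.
- exact: gauss_integrable_Z (gauss_int_monomialE e).1.
- have -> : (fun x => coord c k x * F x * monomialE e x) =
    (fun x => F x * monomialE (incE e c k) x).
    by apply/funext => x; rewrite monomialE_inc; ring.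
  exact: IH.
- under eq_fun do rewrite mulrDl.
  exact: gauss_integrable_D.
- exact: IH.
Qed.

Lemma monomialE0 (x : X) : monomialE (fun=> (0%N, 0%N)) x = 1.
Proof. by rewrite /monomialE big1// => j _; rewrite !expr0 mulr1. Qed.

Lemma polyf_gauss_integrable m F : polyf m F -> gauss_integrable F.
Proof.
move=> pF; have := polyf_gauss_integrable_mono (fun=> (0%N, 0%N)) pF.
by under eq_fun do rewrite monomialE0 mulr1.
Qed.

Lemma gauss_int1_neq0 : gauss_int (fun=> 1) != 0.
Proof.
have -> : (fun=> 1) = monomialE (fun=> (0%N, 0%N)) :> (X -> C).
  by apply/funext => x; rewrite monomialE0.
rewrite (gauss_int_monomialE _).2; apply/prodf_neq0 => k _.
exact: moment2_neq0.
Qed.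

Let ac b : C := if b then a1 else a2.

(** Only the planar factor at position [k] is affected; its parameters are multiplied by [kC k],
    which is the origin of this factor. *)
Lemma ibp_monomialE b k e :
  kC k * (ac b * gauss_int (fun x => coord b k x * monomialE e x) +
          g * gauss_int (fun x => coord (~~ b) k x * monomialE e x)) =
  (degE e b k)%:R * gauss_int (monomialE (decE e b k)).
Proof.
have E (pq : nat * nat) : gauss_int (monomialE (upd e k pq)) =
    mk k pq * \prod_(j | j != k) mk j (e j).
  rewrite (gauss_int_monomialE _).2 (bigD1 k)//= /upd eqxx; congr (_ * _).
  by apply: eq_bigr => j /negPf ->.
have F c : gauss_int (fun x => coord c k x * monomialE e x) = gauss_int (monomialE (incE e c k)).
  by congr gauss_int; apply/funext => x; rewrite monomialE_inc.
rewrite !F /incE /decE !E /degE; set r := \prod_(j | _) _.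
have e1 := moment2_rec1 (e k).1 (e k).2 (pdk k).
have e2 := moment2_rec2 (e k).1 (e k).2 (pdk k).
case: b; rewrite /ac /= /mk /= [RHS]mulrA.
  by rewrite -e1; ring.
by rewrite -e2; ring.
Qed.

(** Strengthened by an accumulating monomial: in the product case the coordinate factor passes into
    it and [dmonomialE] rearranges the derivative, so that the constant case is the formula for
    monomials. *)
Lemma ibp_basis b k F F' e : pder b (fun j => (j == k)%:R) F F' ->
  kC k * (ac b * gauss_int (fun x => coord b k x * (F x * monomialE e x)) +
          g * gauss_int (fun x => coord (~~ b) k x * (F x * monomialE e x))) =
  gauss_int (fun x => F' x * monomialE e x +
    F x * ((degE e b k)%:R * monomialE (decE e b k) x)).
Proof.
move=> dF; elim: dF e => {F F'} [a|c j F F' dF IH|F F' G G' dF IHF dG IHG] e.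
- have L c : gauss_int (fun x => coord c k x * (a * monomialE e x)) =
      a * gauss_int (fun x => coord c k x * monomialE e x).
    rewrite -gauss_int_Z; last first.
      have -> : (fun x : X => coord c k x * monomialE e x) = monomialE (incE e c k).
        by apply/funext => x; rewrite monomialE_inc.
      exact: (gauss_int_monomialE _).1.
    by congr gauss_int; apply/funext => x; rewrite mulrCA.
  rewrite !L.
  have -> : (fun x => 0 * monomialE e x + a * ((degE e b k)%:R * monomialE (decE e b k) x))
    = (fun x => (a * (degE e b k)%:R) * monomialE (decE e b k) x).
    by apply/funext => x; rewrite mul0r add0r mulrA.
  rewrite gauss_int_Z; last exact: (gauss_int_monomialE _).1.
  by rewrite -[in RHS]mulrA -ibp_monomialE; ring.
- have L c' : (fun x => coord c' k x * (coord c j x * F x * monomialE e x)) =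
      (fun x => coord c' k x * (F x * monomialE (incE e c j) x)).
    by apply/funext => x; rewrite monomialE_inc; ring.
  rewrite !L IH; congr gauss_int; apply/funext => x.
  by rewrite dmonomialE monomialE_inc; ring.
- have [m [pF pF']] := polyf_pder dF; have [m' [pG pG']] := polyf_pder dG.
  have cF c m0 H : polyf m0 H -> gauss_integrable (fun x => coord c k x * (H x * monomialE e x)).
    move=> pH; under eq_fun do rewrite mulrA.
    by apply: polyf_gauss_integrable_mono; exact: polyf_mul pH.
  have cD m0 m0' H H' : polyf m0 H -> polyf m0' H' ->
      gauss_integrable (fun x => H' x * monomialE e x +
        H x * ((degE e b k)%:R * monomialE (decE e b k) x)).
    move=> pH pH'; apply: gauss_integrable_D; first exact: polyf_gauss_integrable_mono pH'.
    under eq_fun do rewrite mulrCA.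
    by apply: gauss_integrable_Z; exact: polyf_gauss_integrable_mono pH.
  have L c : gauss_int (fun x => coord c k x * ((F x + G x) * monomialE e x)) =
      gauss_int (fun x => coord c k x * (F x * monomialE e x)) +
      gauss_int (fun x => coord c k x * (G x * monomialE e x)).
    rewrite -gauss_int_D; [|exact: cF pF|exact: cF pG].
    by congr gauss_int; apply/funext => x; ring.
  rewrite !L.
  transitivity (gauss_int (fun x => F' x * monomialE e x +
      F x * ((degE e b k)%:R * monomialE (decE e b k) x)) +
    gauss_int (fun x => G' x * monomialE e x +
      G x * ((degE e b k)%:R * monomialE (decE e b k) x))).
    by rewrite -IHF -IHG; ring.
  rewrite -gauss_int_D; [|exact: cD pF pF'|exact: cD pG pG'].
  by congr gauss_int; apply/funext => x; ring.
Qed.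

Lemma ibp b k F F' : pder b (fun j => (j == k)%:R) F F' ->
  kC k * (ac b * gauss_int (fun x => coord b k x * F x) +
          g * gauss_int (fun x => coord (~~ b) k x * F x)) = gauss_int F'.
Proof.
move=> /(ibp_basis (fun=> (0%N, 0%N))).
have degE0 : degE (fun=> (0%N, 0%N)) b k = 0%N by rewrite /degE; case: b.
have E c : (fun x : X => coord c k x * (F x * monomialE (fun=> (0%N, 0%N)) x)) =
  (fun x => coord c k x * F x) by apply/funext => x; rewrite monomialE0 mulr1.
have E' : (fun x : X => F' x * monomialE (fun=> (0%N, 0%N)) x +
    F x * ((degE (fun=> (0%N, 0%N)) b k)%:R *
      monomialE (decE (fun=> (0%N, 0%N)) b k) x)) = F'.
  by apply/funext => x; rewrite degE0 monomialE0 mulr1 mul0r mulr0 addr0.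
by rewrite !E E'.
Qed.

End gaussian_moments.

(** * Polynomial extension of the expectation *)

Section trivariate_horner.
Variable R : realType.
Local Notation C := R[i].
Implicit Types P Q : {poly {poly {poly C}}}.

Lemma horner3D P Q (x y z : C) :
  horner3 (P + Q) x y z = horner3 P x y z + horner3 Q x y z.
Proof. by rewrite /horner3 !hornerD. Qed.

Lemma horner3B P Q (x y z : C) :
  horner3 (P - Q) x y z = horner3 P x y z - horner3 Q x y z.
Proof. by rewrite /horner3 !(hornerD, hornerN). Qed.

Lemma horner3M P Q (x y z : C) :
  horner3 (P * Q) x y z = horner3 P x y z * horner3 Q x y z.
Proof. by rewrite /horner3 !hornerM. Qed.

Lemma horner3C (c x y z : C) : horner3 c%:P%:P%:P x y z = c.
Proof. by rewrite /horner3 !hornerC. Qed.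

Lemma horner3X (x y z : C) : horner3 'X x y z = x.
Proof. by rewrite /horner3 hornerX !hornerC. Qed.

Lemma horner3Y (x y z : C) : horner3 'X%:P x y z = y.
Proof. by rewrite /horner3 hornerC hornerX hornerC. Qed.

Lemma horner3Z (x y z : C) : horner3 'X%:P%:P x y z = z.
Proof. by rewrite /horner3 !hornerC hornerX. Qed.

Lemma poly_eq0_inj (D : idomainType) (p : {poly D}) (s : nat -> D) :
  injective s -> (forall i, p.[s i] = 0) -> p = 0.
Proof.
move=> s_inj ps0; apply/eqP; apply: contraT => p0.
have := max_poly_roots p0 (rs := [seq s i | i <- iota 0 (size p)]).
rewrite size_map size_iota ltnn map_inj_uniq// iota_uniq => -> //.
by apply/allP => _ /mapP[i _ ->]; apply/rootP.
Qed.

Lemma horner3_eq0_inj P (xs ys zs : nat -> C) :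
  injective xs -> injective ys -> injective zs ->
  (forall i j k, horner3 P (xs i) (ys j) (zs k) = 0) -> P = 0.
Proof.
move=> ix iy iz H; apply: (@poly_eq0_inj _ _ (fun i => (xs i)%:P%:P)).
  by move=> i j /polyC_inj /polyC_inj /ix.
move=> i; apply: (@poly_eq0_inj _ _ (fun j => (ys j)%:P)).
  by move=> j j' /polyC_inj /iy.
by move=> j; apply: (@poly_eq0_inj _ _ zs) => // k; exact: H.
Qed.

End trivariate_horner.

Section polynomial_extension.
Variables (R : realType) (n : nat).
Hypothesis n0 : (0 < n)%N.
Local Notation C := R[i].
Local Notation N := (n * n)%N.
Local Notation coords := (N.-tuple (measurableTypeR R)).
Local Notation X := (coords * coords)%type.
Implicit Types (F G H : X -> C) (c b : bool) (k : 'I_N).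
Implicit Types P Q : {poly {poly {poly C}}}.

(** The analogue of [extends_gauss_mean] for functions of the real coordinates, since the induction
    passes through coordinate derivatives, and on a parameter domain that does not depend on the
    function. *)
Definition extension_of H P := forall a1 a2 g, pos_def a1 a2 g ->
  let d := delta a1 a2 g in
  gauss_int a1 a2 g H / gauss_int a1 a2 g ((fun=> 1) : X -> C) =
  horner3 P (a1 / d) (a2 / d) (g / d).

Lemma ext_uniq H P Q : extension_of H P -> extension_of H Q -> P = Q.
Proof.
move=> eP eQ; apply/eqP; rewrite -subr_eq0; apply/eqP.
have detE (x y z D : R) : D != 0 -> D = x * y - z ^+ 2 ->
    x / D * (y / D) - (z / D) ^+ 2 = D^-1.
  move=> D0 DE; have -> : x / D * (y / D) - (z / D) ^+ 2 =
    (x * y - z ^+ 2) / D ^+ 2 by field.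
  by rewrite -DE; field.
(* With [x, y >= 2] and [0 < z <= 1] the determinant [D = x y - z^2] is positive. The triple
   [(x, y, z) / D] is then positive definite with [delta = 1 / D], so dividing it by its [delta]
   returns [(x, y, z)]. *)
pose xr (i : nat) : R := i.+2%:R; pose zr (i : nat) : R := (i.+1%:R)^-1.
have xr_inj : injective (fun i => (xr i)%:C).
  by move=> i j [] /eqP; rewrite eqr_nat => /eqP [].
have zr_inj : injective (fun i => (zr i)%:C).
  by move=> i j [] /invr_inj /eqP; rewrite eqr_nat => /eqP [].
apply: (@horner3_eq0_inj _ _ (fun i => (xr i)%:C) (fun i => (xr i)%:C)
  (fun i => (zr i)%:C)) => // i j k.
rewrite horner3B; set x := xr i; set y := xr j; set z := zr k.
have x2 : 2 <= x by rewrite ler_nat.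
have y2 : 2 <= y by rewrite ler_nat.
have z0 : 0 < z by rewrite invr_gt0.
have z1 : z <= 1 by rewrite invf_le1// ler1n.
pose D := x * y - z ^+ 2.
have D0 : 0 < D by rewrite /D; nra.
have pd : pos_def (x / D)%:C (y / D)%:C (z / D)%:C.
  have ? : 0 < x by lra.
  have ? : 0 < y by lra.
  split; rewrite /= ?divr_gt0// -subr_gt0.
  by rewrite (@detE x y z D) ?gt_eqF// invr_gt0.
have dE : delta (x / D)%:C (y / D)%:C (z / D)%:C = (D^-1)%:C.
  rewrite /delta -!(rmorphM, rmorphXn, rmorphB); congr (_%:C).
  by apply: detE => //; rewrite gt_eqF.
have qE (u : R) : (u / D)%:C / (D^-1)%:C = u%:C.
  by rewrite -fmorphV -rmorphM /=; congr (_%:C); field; rewrite gt_eqF.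
have := eP _ _ _ pd; have := eQ _ _ _ pd.
by rewrite /= dE !qE => -> ->; rewrite subrr.
Qed.

Lemma ext_cst (a : C) : extension_of (fun=> a) a%:P%:P%:P.
Proof.
move=> a1 a2 g pd d; rewrite horner3C.
have -> : (fun=> a) = (fun x : X => a * 1) by apply/funext => x; rewrite mulr1.
rewrite gauss_int_Z; last exact: polyf_gauss_integrable pd _ _ (polyf_cst _ 1).
by rewrite mulfK ?gauss_int1_neq0.
Qed.

Lemma ext_add m F G P Q : polyf m F -> polyf m G -> extension_of F P -> extension_of G Q ->
  extension_of (fun x => F x + G x) (P + Q).
Proof.
move=> pF pG eF eG a1 a2 g pd d; rewrite horner3D -eF// -eG//.
by rewrite (gauss_int_D (polyf_gauss_integrable pd pF) (polyf_gauss_integrable pd pG)) mulrDl.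
Qed.

Lemma ext_scale m F P (a : C) : polyf m F -> extension_of F P ->
  extension_of (fun x => a * F x) (a%:P%:P%:P * P).
Proof.
move=> pF eF a1 a2 g pd d; rewrite horner3M horner3C -eF//.
by rewrite (gauss_int_Z a (polyf_gauss_integrable pd pF)) mulrA.
Qed.

Let kinv k : {poly {poly {poly C}}} := ((entry_weight R k)%:C^-1)%:P%:P%:P.

(* Integration by parts gives two linear equations for the expectations of
   [x_k F] and [y_k F]; the inverse of their matrix has entries
   [a2 / delta], [- g / delta], [a1 / delta]. *)
Lemma ext_coord m k F Fx Fy P Q : polyf m F ->
  pder true (fun j => (j == k)%:R) F Fx ->
  pder false (fun j => (j == k)%:R) F Fy ->
  extension_of Fx P -> extension_of Fy Q ->
  extension_of (fun x => coord true k x * F x) (kinv k * ('X%:P * P - 'X%:P%:P * Q)) /\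
  extension_of (fun x => coord false k x * F x) (kinv k * ('X * Q - 'X%:P%:P * P)).
Proof.
move=> pF dx dy eP eQ.
have solve (a1 a2 g d K Z A B : C) : Z != 0 -> d != 0 -> K != 0 ->
    d = delta a1 a2 g -> A / Z =
    K^-1 * (a2 / d * (K * (a1 * A + g * B) / Z) -
            g / d * (K * (a2 * B + g * A) / Z)).
  move=> Z0 d0 K0 dE.
  have -> : K^-1 * (a2 / d * (K * (a1 * A + g * B) / Z) -
      g / d * (K * (a2 * B + g * A) / Z)) =
      A * (a1 * a2 - g ^+ 2) / (d * Z).
    by field; rewrite Z0 d0 K0.
  by rewrite -[a1 * a2 - _]/(delta a1 a2 g) -dE; field; rewrite Z0 d0.
have k0 : (entry_weight R k)%:C != 0 :> C.
  by rewrite eq_complex /= eqxx andbT gt_eqF ?entry_weight_gt0.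
split=> a1 a2 g pd d; have Z0 := gauss_int1_neq0 n pd; have d0 : d != 0 := pos_def_delta n0 pd;
  have := ibp pd dx; have := ibp pd dy; rewrite /= => ey ex;
  rewrite !(horner3M, horner3B, horner3C, horner3X, horner3Y, horner3Z);
  rewrite -eP// -eQ// -ex -ey; apply: solve => //.
by rewrite /d /delta mulrC.
Qed.

Lemma ext_exists m F : polyf m F -> exists P, extension_of F P.
Proof.
have [M] := ubnP m; elim: M m F => // M IHM m F lt_m pF.
(* Sums and weakenings use this inner induction; a product with a coordinate uses the outer one,
   through the derivatives of the other factor. *)
elim: pF lt_m => {m F} [a|m c k F pF _|m F G pF IHF pG IHG|m F _ IHF] lt_m.
- by exists a%:P%:P%:P; exact: ext_cst.
- have [Fx [dx px _]] := pder_exists true (fun j => (j == k)%:R) pF.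
  have [Fy [dy py _]] := pder_exists false (fun j => (j == k)%:R) pF.
  have lt_m' : (m.-1 < M)%N by apply: leq_ltn_trans (leq_pred m) _.
  have [P eP] := IHM _ _ lt_m' px; have [Q eQ] := IHM _ _ lt_m' py.
  have [e1 e2] := ext_coord pF dx dy eP eQ.
  by case: c; [eexists; exact: e1 | eexists; exact: e2].
- have [P eP] := IHF lt_m; have [Q eQ] := IHG lt_m.
  by exists (P + Q); exact: ext_add pF pG eP eQ.
- by apply: IHF; exact: ltnW.
Qed.

Lemma pos_def_gauss_domain (F : 'M[C]_n -> 'M[C]_n -> C) m a1 a2 g :
  polyf m (fun x : X => F (herm_mx x.1) (herm_mx x.2)) -> pos_def a1 a2 g ->
  gauss_domain F a1 a2 g.
Proof.
move=> pF pd; split; last 2 first.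
- exact: (polyf_gauss_integrable pd (polyf_cst _ 1)).
- exact: (polyf_gauss_integrable pd pF).
move=> phi; case: pd => A0 B0 G0.
rewrite expRN mulr_natl mulr2n !(ReN, ReD, ReM) /= !mulr0 !subr0.
have u0 := expR_gt0 phi; set u := expR phi in u0 *.
set A := complex.Re a1 in A0 G0 *; set B := complex.Re a2 in B0 G0 *.
set G := complex.Re g in G0 *.
have Au0 : 0 < A * u by rewrite mulr_gt0.
(* Multiplication by [A u > 0] permits completing the square, with remainder [A B - G^2 > 0]. *)
split; rewrite -(pmulr_rgt0 _ Au0).
  have -> : A * u * (A * u + B * u^-1 + (G + G)) =
    (A * u + G) ^+ 2 + (A * B - G ^+ 2) by field; rewrite gt_eqF.
  by rewrite ltr_pwDr ?sqr_ge0// subr_gt0.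
have -> : A * u * (A * u + B * u^-1 - (G + G)) =
  (A * u - G) ^+ 2 + (A * B - G ^+ 2) by field; rewrite gt_eqF.
by rewrite ltr_pwDr ?sqr_ge0// subr_gt0.
Qed.

(** For polynomial [F] the set [gauss_domain F] is exactly [pos_def], so both notions of extension
    have the same unique solution, and [xget] returns it. *)
Lemma expectH_ext (F : 'M[C]_n -> 'M[C]_n -> C) m P a1 a2 g :
  polyf m (fun x : X => F (herm_mx x.1) (herm_mx x.2)) ->
  extension_of (fun x : X => F (herm_mx x.1) (herm_mx x.2)) P ->
  expectH F a1 a2 g =
  horner3 P (a1 / delta a1 a2 g) (a2 / delta a1 a2 g) (g / delta a1 a2 g).
Proof.
move=> pF eP; have gm (b1 b2 h : C) : gauss_mean F b1 b2 h =
    gauss_int b1 b2 h (fun x : X => F (herm_mx x.1) (herm_mx x.2)) /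
    gauss_int b1 b2 h ((fun=> 1) : X -> C) by [].
rewrite /expectH (_ : xget 0 [set Q | extends_gauss_mean F Q] = P)//.
apply: xget_subset1.
  move=> b1 b2 h dom d; rewrite gm.
  by apply: eP; exact: gauss_domain_pos_def dom.
move=> Q Q' /= eQ eQ'; apply: (@ext_uniq (fun x => F (herm_mx x.1) (herm_mx x.2))).
  by move=> b1 b2 h pd d; rewrite -gm; apply: eQ; exact: pos_def_gauss_domain pF pd.
by move=> b1 b2 h pd d; rewrite -gm; apply: eQ'; exact: pos_def_gauss_domain pF pd.
Qed.

End polynomial_extension.

(** * Derivatives with respect to matrix entries *)

Section entries.
Variables (R : realType) (n : nat).
Local Notation C := R[i].
Local Notation N := (n * n)%N.
Local Notation coords := (N.-tuple (measurableTypeR R)).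
Local Notation X := (coords * coords)%type.
Local Notation I := (0 +i* 1 : C).
Implicit Types (c b : bool) (i j p q r s : 'I_n).

(* Entry (i, j) of a Hermitian matrix is the combination of its real coordinates
   with the following coefficients. *)
Definition herm_coef i j r s : C :=
  if i == j then ((r == i) && (s == i))%:R
  else if (i < j)%N then ((r == i) && (s == j))%:R + I * ((r == j) && (s == i))%:R
  else ((r == j) && (s == i))%:R - I * ((r == i) && (s == j))%:R.

Definition herm_vec i j (k : 'I_N) : C := (mxvec (\matrix_(r, s) herm_coef i j r s)) 0 k.

Lemma herm_vecE i j r s : herm_vec i j (mxvec_index r s) = herm_coef i j r s.
Proof. by rewrite /herm_vec mxvecE mxE. Qed.

(* The derivation along [herm_dir i j] is the derivation with respect to the entry
   (j, i), all entries being considered as independent variables. *)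
Definition herm_dir i j (k : 'I_N) : C := (entry_weight R k)%:C^-1 * herm_vec i j k.

Lemma sum_herm_vec i j (u : 'I_N -> C) : \sum_k herm_vec i j k * u k =
  if i == j then u (mxvec_index i i)
  else if (i < j)%N then u (mxvec_index i j) + I * u (mxvec_index j i)
  else u (mxvec_index j i) - I * u (mxvec_index i j).
Proof.
have S i' j' : \sum_r \sum_s ((r == i') && (s == j'))%:R * u (mxvec_index r s) =
    u (mxvec_index i' j').
  rewrite (bigD1 i')//= [X in _ + X]big1 ?addr0 => [|r ri]; last first.
    by rewrite big1// => s _; rewrite (negPf ri) mul0r.
  rewrite (bigD1 j')//= [X in _ + X]big1 ?addr0 => [|s sj].
    by rewrite !eqxx mul1r.
  by rewrite (negPf sj) andbF mul0r.
rewrite sum_mxvec; under eq_bigr do under eq_bigr do rewrite herm_vecE /herm_coef.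
have [ij|ij] := eqVneq i j; first by rewrite S.
have SI i' j' : \sum_r \sum_s I * ((r == i') && (s == j'))%:R * u (mxvec_index r s) =
    I * u (mxvec_index i' j').
  rewrite -S mulr_sumr; apply: eq_bigr => r _; rewrite mulr_sumr.
  by apply: eq_bigr => s _; rewrite mulrA.
case: ltnP => _.
  under eq_bigr do (under eq_bigr do rewrite mulrDl; rewrite big_split).
  by rewrite big_split /= S SI.
under eq_bigr do (under eq_bigr do rewrite mulrBl; rewrite sumrB).
by rewrite sumrB /= S SI.
Qed.

Definition herm_of c (x : X) : 'M[C]_n := herm_mx (if c then x.1 else x.2).

Lemma herm_ofE c x i j : herm_of c x i j = \sum_k herm_vec i j k * coord c k x.
Proof.
rewrite sum_herm_vec /herm_of mxE /coord; case: eqP => [->//|_].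
by case: ifP => _; apply: complex_ext => /=; ring.
Qed.

(** The pairing is bilinear, without conjugation: an off-diagonal entry [x + i y] paired with itself
    gives [(1 + i^2) / 2 = 0], and with its transpose [(1 - i^2) / 2 = 1]. Hence the interchange of
    [i] and [j]. *)
Lemma sum_herm_vec_dir i j p q :
  \sum_k herm_vec p q k * herm_dir i j k = ((p == j) && (q == i))%:R.
Proof.
rewrite sum_herm_vec /herm_dir !entry_weightE !herm_vecE /herm_coef [q == p]eq_sym.
rewrite [(q == i) && _]andbC [(q == j) && _]andbC.
have one : (1%:C : C)^-1 = 1 by rewrite invr1.
have two : (2%:C : C)^-1 = (2^-1)%:C by rewrite fmorphV.
have E0 : (false%:R : C) = 0 by [].
have E1 : (true%:R : C) = 1 by [].
have [<-|pq] := eqVneq p q; have [<-|ij] := eqVneq i j.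
- by rewrite !eqxx one mul1r andbb.
- have -> : (p == i) && (p == j) = false.
    by apply: contraNF ij => /andP[/eqP <- /eqP <-].
  rewrite [(p == j) && _]andbC.
  have -> : (p == i) && (p == j) = false.
    by apply: contraNF ij => /andP[/eqP <- /eqP <-].
  by rewrite eqxx one mul1r E0; case: ifP => _; apply: complex_ext => /=; ring.
- have -> : (p == i) && (q == i) = false.
    by apply: contraNF pq => /andP[/eqP -> /eqP ->].
  by rewrite E0 two; case: ifP => _; apply: complex_ext => /=; ring.
rewrite two [(q == i) && (p == j)]andbC.
set x := (p == i) && (q == j); set y := (p == j) && (q == i).
have [lt_pq|le_qp] := ltnP p q; have [lt_ij|le_ji] := ltnP i j.
- have -> : y = false.
    apply/negP => /andP[/eqP pj /eqP qi].
    by move: lt_pq; rewrite pj qi ltnNge (ltnW lt_ij).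
  by case: x; rewrite ?E0 ?E1; apply: complex_ext => /=; field.
- by case: x; case: y; rewrite ?E0 ?E1; apply: complex_ext => /=; field.
- by case: x; case: y; rewrite ?E0 ?E1; apply: complex_ext => /=; field.
- have -> : y = false.
    apply/negP => /andP[/eqP pj /eqP qi].
    by move: ij; rewrite -(inj_eq val_inj) eqn_leq -{1}qi -{1}pj le_qp le_ji.
  by case: x; rewrite ?E0 ?E1; apply: complex_ext => /=; field.
Qed.

End entries.

(** * The Leibniz rule for words and traces *)

Section matrix_functions.
Variables (R : realType) (n : nat).
Local Notation C := R[i].
Local Notation N := (n * n)%N.
Local Notation coords := (N.-tuple (measurableTypeR R)).
Local Notation X := (coords * coords)%type.
Implicit Types (F G H : X -> C) (b c : bool) (i j p q : 'I_n).
Implicit Types f h : X -> 'M[C]_n.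

Definition polynomial_fun F := exists m, polyf m F.

Definition polynomial_mx f := forall p q, polynomial_fun (fun x => f x p q).

Lemma polynomial_fun_cst (a : C) : polynomial_fun (fun=> a).
Proof. by exists 0%N; exact: polyf_cst. Qed.

Lemma polynomial_fun_add F G : polynomial_fun F -> polynomial_fun G -> polynomial_fun (fun x => F x + G x).
Proof.
move=> [m pF] [m' pG]; exists (maxn m m').
by apply: polyf_add; [apply: polyf_weaken pF; exact: leq_maxl |
  apply: polyf_weaken pG; exact: leq_maxr].
Qed.

Lemma polynomial_fun_mul F G : polynomial_fun F -> polynomial_fun G -> polynomial_fun (fun x => F x * G x).
Proof. by move=> [m pF] [m' pG]; exists (m + m')%N; exact: polyfM. Qed.

Lemma polynomial_fun_sum J (r : seq J) (K : pred J) (F : J -> X -> C) :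
  (forall t, polynomial_fun (F t)) -> polynomial_fun (fun x => \sum_(t <- r | K t) F t x).
Proof.
move=> pF; elim: r => [|t r IHr].
  by under eq_fun do rewrite big_nil; exact: polynomial_fun_cst.
under eq_fun do rewrite big_cons; case: (K t) => //.
exact: polynomial_fun_add.
Qed.

Lemma polynomial_fun_prod J (r : seq J) (K : pred J) (F : J -> X -> C) :
  (forall t, polynomial_fun (F t)) -> polynomial_fun (fun x => \prod_(t <- r | K t) F t x).
Proof.
move=> pF; elim: r => [|t r IHr].
  by under eq_fun do rewrite big_nil; exact: polynomial_fun_cst.
under eq_fun do rewrite big_cons; case: (K t) => //.
exact: polynomial_fun_mul.
Qed.

Lemma polynomial_fun_trace f : polynomial_mx f -> polynomial_fun (fun x => \tr (f x)).
Proof. by move=> pf; apply: polynomial_fun_sum => p; exact: pf. Qed.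

Lemma polynomial_mx_1 : polynomial_mx (fun=> 1).
Proof. by move=> p q; exact: polynomial_fun_cst. Qed.

Lemma polynomial_mx_herm_of c : polynomial_mx (herm_of c).
Proof.
move=> p q; under eq_fun do rewrite herm_ofE.
apply: polynomial_fun_sum => k; apply: polynomial_fun_mul; first exact: polynomial_fun_cst.
exists 1%N; have -> : coord c k = (fun x : X => coord c k x * 1).
  by apply/funext => x; rewrite mulr1.
by apply: polyf_mul; exact: polyf_cst.
Qed.

Lemma polynomial_mx_mul f h : polynomial_mx f -> polynomial_mx h -> polynomial_mx (fun x => f x * h x).
Proof.
move=> pf ph p q; under eq_fun do rewrite mxE.
by apply: polynomial_fun_sum => s; apply: polynomial_fun_mul; [exact: pf | exact: ph].
Qed.

Lemma polynomial_mx_exp f k : polynomial_mx f -> polynomial_mx (fun x => f x ^+ k).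
Proof.
move=> pf; elim: k => [|k IHk]; first exact: polynomial_mx_1.
by under eq_fun do rewrite exprS; exact: polynomial_mx_mul.
Qed.

Lemma polynomial_mx_prod J (r : seq J) (h : J -> X -> 'M[C]_n) :
  (forall t, polynomial_mx (h t)) -> polynomial_mx (fun x => \prod_(t <- r) h t x).
Proof.
move=> ph; elim: r => [|t r IHr].
  by under eq_fun do rewrite big_nil; exact: polynomial_mx_1.
by under eq_fun do rewrite big_cons; exact: polynomial_mx_mul.
Qed.

Lemma polynomial_mx_word k l r s :
  polynomial_mx (fun x => word k l r s (herm_of true x) (herm_of false x)).
Proof.
apply: polynomial_mx_prod => u.
by apply: polynomial_mx_mul; apply: polynomial_mx_exp; exact: polynomial_mx_herm_of.
Qed.

Definition mder b i j f (f' : X -> 'M[C]_n) := forall p q,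
  pder b (herm_dir R i j) (fun x => f x p q) (fun x => f' x p q).

Lemma mder_ext b i j f f' h h' :
  mder b i j f f' -> f =1 h -> f' =1 h' -> mder b i j h h'.
Proof. by move=> df /funext <- /funext <-. Qed.

Lemma mder1 b i j : mder b i j (fun=> 1) (fun=> 0).
Proof.
move=> p q; have -> : (fun x : X => (0 : 'M[C]_n) p q) = (fun=> 0).
  by apply/funext => x; rewrite mxE.
exact: pder_cst.
Qed.

Lemma mder_herm_of c b i j :
  mder b i j (herm_of c) (fun=> (c == b)%:R *: delta_mx j i).
Proof.
move=> p q; have -> : (fun x => herm_of c x p q) =
    (fun x => \sum_k herm_vec R p q k * (coord c k x * 1)).
  by apply/funext => x; rewrite herm_ofE; apply: eq_bigr => k _; rewrite mulr1.
have -> : (fun x : X => ((c == b)%:R *: delta_mx j i : 'M[C]_n) p q) =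
    (fun x => \sum_k herm_vec R p q k *
      (((c == b)%:R * herm_dir R i j k) * 1 + coord c k x * 0)).
  apply/funext => x; rewrite !mxE -sum_herm_vec_dir mulr_sumr.
  by apply: eq_bigr => k _; rewrite mulr0 addr0 mulr1 mulrCA.
apply: pder_sum => k; apply: pderZ; apply: pder_mul; exact: pder_cst.
Qed.

Lemma mderM b i j f f' h h' : mder b i j f f' -> mder b i j h h' ->
  mder b i j (fun x => f x * h x) (fun x => f' x * h x + f x * h' x).
Proof.
move=> df dh p q.
have -> : (fun x => (f x * h x) p q) = (fun x => \sum_s f x p s * h x s q).
  by apply/funext => x; rewrite mxE.
have -> : (fun x => (f' x * h x + f x * h' x) p q) =
    (fun x => \sum_s (f' x p s * h x s q + f x p s * h' x s q)).
  by apply/funext => x; rewrite !mxE big_split.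
by apply: pder_sum => s; apply: pderM; [exact: df | exact: dh].
Qed.

Lemma mder_exp c b i j k : mder b i j (fun x => herm_of c x ^+ k)
  (fun x => (c == b)%:R *: \sum_(0 <= m < k)
    herm_of c x ^+ m * delta_mx j i * herm_of c x ^+ (k - m - 1)).
Proof.
elim: k => [|k IHk].
  apply: mder_ext (mder1 b i j) _ _ => x //.
  by rewrite big_geq// scaler0.
apply: mder_ext (mderM IHk (mder_herm_of c b i j)) _ _ => x; first by rewrite exprSr.
have sAl a (A B : 'M[C]_n) : (a *: A) * B = a *: (A * B).
  exact: esym (scalemxAl a A B).
have sAr a (A B : 'M[C]_n) : A * (a *: B) = a *: (A * B).
  exact: esym (scalemxAr a A B).
rewrite big_nat_recr//= scalerDr sAl sAr subSnn subnn expr0 mulr1.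
congr (_ *: _ + _); rewrite big_distrl /= !big_nat; apply: eq_bigr => m /andP[_ mk].
by rewrite -mulrA -exprSr subSn ?(ltnW mk)// subn1 subn1 prednK ?subn_gt0.
Qed.

Lemma mder_prod b i j (h h' : nat -> X -> 'M[C]_n) r s :
  (forall u, mder b i j (h u) (h' u)) ->
  mder b i j (fun x => \prod_(r <= u < s) h u x)
    (fun x => \sum_(r <= t < s) (\prod_(r <= u < t) h u x) * h' t x *
      \prod_(t.+1 <= u < s) h u x).
Proof.
move=> dh; elim: s => [|s IHs].
  by apply: mder_ext (mder1 b i j) _ _ => x; rewrite big_geq.
have [rs|sr] := leqP r s; last first.
  by apply: mder_ext (mder1 b i j) _ _ => x; rewrite big_geq.
apply: mder_ext (mderM IHs (dh s)) _ _ => x; first by rewrite [RHS]big_nat_recr.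
rewrite [RHS]big_nat_recr//= [\prod_(s.+1 <= u < s.+1) _]big_geq// mulr1.
congr (_ + _); rewrite big_distrl /= !big_nat; apply: eq_bigr => t /andP[_ ts].
by rewrite big_nat_recr//= mulrA.
Qed.

(** Each summand cuts the word at one letter [A]. The two pieces are grouped on either side of
    [delta_mx j i], the form required by the trace identities below. *)
Lemma mder_word_true i j k l s :
  mder true i j (fun x => word k l 1 s (herm_of true x) (herm_of false x))
  (fun x => let A := herm_of true x in let B := herm_of false x in
    \sum_(1 <= r < s) \sum_(0 <= m < k r)
      (word k l 1 r A B * A ^+ m) * delta_mx j i *
      (A ^+ (k r - m - 1) * B ^+ l r * word k l r.+1 s A B)).
Proof.
have dh u := mderM (mder_exp true true i j (k u)) (mder_exp false true i j (l u)).
apply: mder_ext (mder_prod 1 s dh) _ _ => x //=.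
apply: eq_bigr => r _; rewrite scale1r scale0r mulr0 addr0.
rewrite !(big_distrl, big_distrr) /=; apply: eq_bigr => m _.
by rewrite /word !mulrA.
Qed.

Lemma mder_word_false i j k l s :
  mder false i j (fun x => word k l 1 s (herm_of true x) (herm_of false x))
  (fun x => let A := herm_of true x in let B := herm_of false x in
    \sum_(1 <= r < s) \sum_(0 <= m < l r)
      (word k l 1 r A B * A ^+ k r * B ^+ m) * delta_mx j i *
      (B ^+ (l r - m - 1) * word k l r.+1 s A B)).
Proof.
have dh u := mderM (mder_exp true false i j (k u)) (mder_exp false false i j (l u)).
apply: mder_ext (mder_prod 1 s dh) _ _ => x //=.
apply: eq_bigr => r _; rewrite scale1r scale0r mul0r add0r.
rewrite !(big_distrl, big_distrr) /=; apply: eq_bigr => m _.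
by rewrite /word !mulrA.
Qed.

Lemma pder_trace b i j f f' : mder b i j f f' ->
  pder b (herm_dir R i j) (fun x => \tr (f x)) (fun x => \tr (f' x)).
Proof. by move=> df; apply: pder_sum => p; exact: df. Qed.

Lemma pder_prod b v (r : seq nat) (T T' : nat -> X -> C) : uniq r ->
  (forall t, pder b v (T t) (T' t)) ->
  pder b v (fun x => \prod_(u <- r) T u x)
    (fun x => \sum_(t <- r) (\prod_(u <- r | u != t) T u x) * T' t x).
Proof.
move=> + dT; elim: r => [_|t r IHr /= /andP[tr ur]].
  under eq_fun do rewrite big_nil.
  under [X in pder _ _ _ X]eq_fun do rewrite big_nil.
  exact: pder_cst.
have -> : (fun x => \prod_(u <- t :: r) T u x) =
    (fun x => T t x * \prod_(u <- r) T u x).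
  by apply/funext => x; rewrite big_cons.
have -> : (fun x => \sum_(t0 <- t :: r) (\prod_(u <- t :: r | u != t0) T u x) * T' t0 x)
    = (fun x => T' t x * (\prod_(u <- r) T u x) +
        T t x * (\sum_(t0 <- r) (\prod_(u <- r | u != t0) T u x) * T' t0 x)).
  apply/funext => x; rewrite big_cons big_cons eqxx /= mulrC; congr (_ * _ + _).
    rewrite big_seq_cond [RHS]big_seq; apply: eq_bigl => u.
    by rewrite andb_idr// => ur'; apply: contraNneq tr => <-.
  rewrite mulr_sumr big_seq [RHS]big_seq; apply: eq_bigr => u ur'.
  rewrite big_cons ifT ?mulrA//.
  by apply: contraNneq tr => ->.
exact: pderM (dT t) (IHr ur).
Qed.

(** Splitting of a trace: the entry [(j, i)] of the product is [P j j * Q i i]. *)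
Lemma sum_delta_trace (P Q : 'M[C]_n) :
  \sum_i \sum_j (P * delta_mx j i * Q) j i = \tr P * \tr Q.
Proof.
rewrite [\tr P * _]mulrC /mxtrace mulr_suml; apply: eq_bigr => i _.
rewrite mulr_sumr; apply: eq_bigr => j _.
rewrite mxE (bigD1 i)//= big1 ?addr0 => [|s si].
  rewrite mxE (bigD1 j)//= big1 ?addr0 => [|s sj].
    by rewrite mxE !eqxx mulr1 mulrC.
  by rewrite mxE (negPf sj) mulr0.
rewrite mxE big1 ?mul0r// => t _.
by rewrite mxE (negPf si) andbF mulr0.
Qed.

Lemma mxtrace_rot (P f Q : 'M[C]_n) : \tr (P * f * Q) = \tr (Q * P * f).
Proof. by rewrite -[P * f * Q]/(P *m f *m Q) mxtrace_mulC mulmxA. Qed.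

Lemma trace_delta (P Q : 'M[C]_n) i j :
  \tr (P * delta_mx j i * Q) = (Q * P) i j.
Proof.
rewrite mxtrace_rot /mxtrace (bigD1 i)//= big1 ?addr0 => [|t ti].
  rewrite mxE (bigD1 j)//= big1 ?addr0 => [|s sj].
    by rewrite [delta_mx _ _ _ _]mxE !eqxx mulr1.
  by rewrite [delta_mx _ _ _ _]mxE (negPf sj) mulr0.
by rewrite mxE big1// => s _; rewrite [delta_mx _ _ _ _]mxE (negPf ti) andbF mulr0.
Qed.

(** Merging of two traces: by cyclicity the trace with [delta_mx j i] is the entry [(i, j)] of
    [Q * P], so the double sum inserts [f] at the cut. *)
Lemma sum_trace_delta (f P Q : 'M[C]_n) :
  \sum_i \sum_j f j i * \tr (P * delta_mx j i * Q) = \tr (P * f * Q).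
Proof.
under eq_bigr do under eq_bigr do rewrite trace_delta.
rewrite mxtrace_rot /mxtrace; apply: eq_bigr => i _; rewrite [RHS]mxE.
by apply: eq_bigr => j _; rewrite mulrC.
Qed.

End matrix_functions.

(** * Loop equations *)

Section extended_expectation.
Variables (R : realType) (n : nat).
Hypothesis n0 : (0 < n)%N.
Variables (a1 a2 g : R[i]).
Hypothesis hdelta : delta a1 a2 g != 0.
Local Notation C := R[i].
Local Notation N := (n * n)%N.
Local Notation coords := (N.-tuple (measurableTypeR R)).
Local Notation X := (coords * coords)%type.
Implicit Types (F G H : X -> C) (b c : bool) (i j p q : 'I_n).

Let d := delta a1 a2 g.

Definition ext_mean H : C :=
  horner3 (xget 0 [set P | extension_of H P]) (a1 / d) (a2 / d) (g / d).

Lemma ext_meanE H P : extension_of H P -> ext_mean H = horner3 P (a1 / d) (a2 / d) (g / d).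
Proof.
move=> eP; rewrite /ext_mean (_ : xget 0 _ = P)//.
by apply: xget_subset1 => // Q Q'; exact: ext_uniq.
Qed.

Lemma expectH_ext_mean (F : 'M[C]_n -> 'M[C]_n -> C) :
  polynomial_fun (fun x : X => F (herm_of true x) (herm_of false x)) ->
  expectH F a1 a2 g = ext_mean (fun x : X => F (herm_of true x) (herm_of false x)).
Proof.
move=> [m pF]; have [P eP] := ext_exists n0 pF.
by rewrite (ext_meanE eP); exact: expectH_ext pF eP.
Qed.

Lemma ext_meanD F G : polynomial_fun F -> polynomial_fun G -> ext_mean (fun x => F x + G x) = ext_mean F + ext_mean G.
Proof.
move=> [m pF] [m' pG]; have [P eP] := ext_exists n0 pF.
have [Q eQ] := ext_exists n0 pG.
have pF' := polyf_weaken (leq_maxl m m') pF.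
have pG' := polyf_weaken (leq_maxr m m') pG.
by rewrite (ext_meanE (ext_add pF' pG' eP eQ)) horner3D (ext_meanE eP) (ext_meanE eQ).
Qed.

Lemma ext_meanZ a F : polynomial_fun F -> ext_mean (fun x => a * F x) = a * ext_mean F.
Proof.
move=> [m pF]; have [P eP] := ext_exists n0 pF.
by rewrite (ext_meanE (ext_scale a pF eP)) horner3M horner3C (ext_meanE eP).
Qed.

Lemma ext_mean_sum J (r : seq J) (F : J -> X -> C) : (forall t, polynomial_fun (F t)) ->
  ext_mean (fun x => \sum_(t <- r) F t x) = \sum_(t <- r) ext_mean (F t).
Proof.
move=> pF; elim: r => [|t r IHr].
  under eq_fun do rewrite big_nil.
  by rewrite big_nil (ext_meanE (ext_cst n 0)) horner3C.
under eq_fun do rewrite big_cons.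
rewrite ext_meanD//; last exact: polynomial_fun_sum.
by rewrite IHr big_cons.
Qed.

Let ac b : C := if b then a1 else a2.

Lemma polynomial_fun_coord c k F : polynomial_fun F -> polynomial_fun (fun x => coord c k x * F x).
Proof. by move=> [m pF]; exists m.+1; exact: polyf_mul. Qed.

(** The extending polynomials of both coordinate products are those of [ext_coord]; at the given
    parameters their values are Cramer's solution of the linear system, and substituting them back
    uses only [delta != 0]. *)
Lemma ext_mean_ibp_coord b (k : 'I_N) F F' : pder b (fun j : 'I_N => (j == k)%:R) F F' ->
  (entry_weight R k)%:C * (ac b * ext_mean (fun x => coord b k x * F x) +
                  g * ext_mean (fun x => coord (~~ b) k x * F x)) = ext_mean F'.
Proof.
move=> dF; have [m [pF _]] := polyf_pder dF.
have k0 : (entry_weight R k)%:C != 0 :> C.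
  by rewrite eq_complex /= eqxx andbT gt_eqF ?entry_weight_gt0.
(* Cramer's rule involves the derivatives in both matrices: the one in direction [b] is taken to be
   the given [F'], the other is supplied by [pder_exists]. *)
have [Fx [dx [P eP] hx]] : exists Fx,
    [/\ pder true (fun j : 'I_N => (j == k)%:R) F Fx, exists P, extension_of Fx P &
     b -> Fx = F'].
  case: b dF => dF.
    by exists F'; split=> //; have [m' [_ /(ext_exists n0)]] := polyf_pder dF.
  have [Fx [dx /(ext_exists n0) px _]] :=
    pder_exists true (fun j : 'I_N => (j == k)%:R) pF.
  by exists Fx.
have [Fy [dy [Q eQ] hy]] : exists Fy,
    [/\ pder false (fun j : 'I_N => (j == k)%:R) F Fy, exists P, extension_of Fy P &
     ~~ b -> Fy = F'].
  case: b dF {hx} => dF; last first.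
    by exists F'; split=> //; have [m' [_ /(ext_exists n0)]] := polyf_pder dF.
  have [Fy [dy /(ext_exists n0) py _]] :=
    pder_exists false (fun j : 'I_N => (j == k)%:R) pF.
  by exists Fy.
have [ex ey] := ext_coord n0 pF dx dy eP eQ.
have {ex} ex := ext_meanE ex; have {ey} ey := ext_meanE ey.
rewrite !(horner3M, horner3B, horner3C, horner3X, horner3Y, horner3Z) in ex ey.
rewrite -(ext_meanE eP) -(ext_meanE eQ) in ex ey.
have solve (K dd A B p q : C) : K != 0 -> dd != 0 -> delta a1 a2 g = dd ->
    A = K^-1 * (a2 / dd * p - g / dd * q) ->
    B = K^-1 * (a1 / dd * q - g / dd * p) ->
    K * (a1 * A + g * B) = p /\ K * (a2 * B + g * A) = q.
  move=> K0 dd0 dE -> ->; split.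
    transitivity (delta a1 a2 g / dd * p); last by rewrite dE divff// mul1r.
    by rewrite /delta; field; rewrite dd0 K0.
  transitivity (delta a1 a2 g / dd * q); last by rewrite dE divff// mul1r.
  by rewrite /delta; field; rewrite dd0 K0.
have [s1 s2] := solve _ _ _ _ _ _ k0 hdelta erefl ex ey.
by case: b {dF} hx hy => hx hy /=; [rewrite s1 hx | rewrite s2 hy].
Qed.

(** The coefficients of the entry [(i, j)] combine the coordinate formulas; the factor
    [entry_weight] of each of them cancels against its inverse in [herm_dir], leaving uniform
    coefficients. *)
Lemma ext_mean_ibp b i j F F' : pder b (herm_dir R i j) F F' ->
  ac b * ext_mean (fun x => herm_of b x i j * F x) +
  g * ext_mean (fun x => herm_of (~~ b) x i j * F x) = ext_mean F'.
Proof.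
move=> dF; have [m [pF _]] := polyf_pder dF; have isF : polynomial_fun F by exists m.
have [D dD DE] := pder_basis dF.
have isD k : polynomial_fun (D k) by have [m' [_ pD]] := polyf_pder (dD k); exists m'.
have k0 k : (entry_weight R k)%:C != 0 :> C.
  by rewrite eq_complex /= eqxx andbT gt_eqF ?entry_weight_gt0.
have alg (K v x y z w : C) : K != 0 ->
    z * (v * x) + w * (v * y) = K^-1 * v * (K * (z * x + w * y)).
  by move=> K0; field.
have L c : ext_mean (fun x => herm_of c x i j * F x) =
    \sum_k herm_vec R i j k * ext_mean (fun x => coord c k x * F x).
  have -> : (fun x => herm_of c x i j * F x) =
      (fun x => \sum_k herm_vec R i j k * (coord c k x * F x)).
    apply/funext => x; rewrite herm_ofE mulr_suml.
    by apply: eq_bigr => k _; rewrite mulrA.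
  rewrite ext_mean_sum; last first.
    by move=> k; apply: polynomial_fun_mul; [exact: polynomial_fun_cst | exact: polynomial_fun_coord].
  by apply: eq_bigr => k _; rewrite ext_meanZ//; exact: polynomial_fun_coord.
have -> : F' = (fun x => \sum_k herm_dir R i j k * D k x) by exact/funext.
rewrite ext_mean_sum; last by move=> k; apply: polynomial_fun_mul => //; exact: polynomial_fun_cst.
rewrite !L !mulr_sumr -big_split; apply: eq_bigr => k _ /=.
rewrite ext_meanZ// -(ext_mean_ibp_coord (dD k)) /herm_dir.
exact: alg.
Qed.

(** Integration by parts for the entry [(j, i)] of [f 0] times [G0], summed over [i] and [j].
    Differentiating the entry splits its trace in two, and differentiating a factor of [G0] merges
    that factor with [f 0]. The cuts of the words are abstracted as [S], [P], [Q], so that one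
    argument serves both matrices. *)
Lemma loop_equation b (p : nat) (f : nat -> X -> 'M[C]_n) (S : nat -> seq (nat * nat))
    (P Q : nat -> nat * nat -> X -> 'M[C]_n) :
  (forall t, polynomial_mx (f t)) -> (forall t s, polynomial_mx (P t s)) ->
  (forall t s, polynomial_mx (Q t s)) ->
  (forall t i j, mder b i j (f t)
    (fun x => \sum_(s <- S t) P t s x * delta_mx j i * Q t s x)) ->
  let G0 x := \prod_(1 <= u < p.+1) \tr (f u x) in
  let G t x := \prod_(1 <= u < p.+1 | u != t) \tr (f u x) in
  ac b * ext_mean (fun x => G0 x * \tr (herm_of b x * f 0%N x)) +
  g * ext_mean (fun x => G0 x * \tr (herm_of (~~ b) x * f 0%N x)) =
  \sum_(s <- S 0%N) ext_mean (fun x => G0 x * \tr (P 0%N s x) * \tr (Q 0%N s x)) +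
  \sum_(1 <= t < p.+1) \sum_(s <- S t)
    ext_mean (fun x => G t x * \tr (P t s x * f 0%N x * Q t s x)).
Proof.
move=> pf pP pQ df G0 G.
have pG0 : polynomial_fun G0 by apply: polynomial_fun_prod => t; exact: polynomial_fun_trace.
have pG t : polynomial_fun (G t) by apply: polynomial_fun_prod => u; exact: polynomial_fun_trace.
pose f' t i j x := \sum_(s <- S t) P t s x * delta_mx j i * Q t s x.
have dG i j : pder b (herm_dir R i j) G0
    (fun x => \sum_(1 <= t < p.+1) G t x * \tr (f' t i j x)).
  by apply: pder_prod => [|t]; [exact: iota_uniq | exact: pder_trace (df t i j)].
pose D i j x := f' 0%N i j x j i * G0 x +
  f 0%N x j i * \sum_(1 <= t < p.+1) G t x * \tr (f' t i j x).
have dD i j : pder b (herm_dir R i j) (fun x => f 0%N x j i * G0 x) (D i j).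
  exact: pderM (df 0%N i j j i) (dG i j).
have pD i j : polynomial_fun (D i j) by have [m [_ pD]] := polyf_pder (dD i j); exists m.
have pfG i j : polynomial_fun (fun x => f 0%N x j i * G0 x) by exact: polynomial_fun_mul (pf 0%N j i) pG0.
have L c : ext_mean (fun x => G0 x * \tr (herm_of c x * f 0%N x)) =
    \sum_i \sum_j ext_mean (fun x => herm_of c x i j * (f 0%N x j i * G0 x)).
  have pcf i j : polynomial_fun (fun x => herm_of c x i j * (f 0%N x j i * G0 x)).
    by apply: polynomial_fun_mul => //; exact: polynomial_mx_herm_of.
  transitivity (ext_mean (fun x => \sum_i \sum_j herm_of c x i j * (f 0%N x j i * G0 x))).
    congr ext_mean; apply/funext => x; rewrite mulrC /mxtrace mulr_suml.
    apply: eq_bigr => i _; rewrite mxE mulr_suml.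
    by apply: eq_bigr => j _; rewrite mulrA.
  rewrite ext_mean_sum; last by move=> i; exact: polynomial_fun_sum.
  by apply: eq_bigr => i _; rewrite ext_mean_sum.
rewrite !L !mulr_sumr -big_split /=.
transitivity (\sum_i \sum_j ext_mean (D i j)).
  apply: eq_bigr => i _; rewrite !mulr_sumr -big_split /=.
  by apply: eq_bigr => j _; exact: ext_mean_ibp.
transitivity (ext_mean (fun x => \sum_i \sum_j D i j x)).
  rewrite ext_mean_sum; last by move=> i; exact: polynomial_fun_sum.
  by apply: eq_bigr => i _; rewrite ext_mean_sum.
have pT1 s : polynomial_fun (fun x => G0 x * \tr (P 0%N s x) * \tr (Q 0%N s x)).
  exact: polynomial_fun_mul (polynomial_fun_mul pG0 (polynomial_fun_trace (pP 0%N s))) (polynomial_fun_trace (pQ 0%N s)).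
have pT2 t s : polynomial_fun (fun x => G t x * \tr (P t s x * f 0%N x * Q t s x)).
  exact: polynomial_fun_mul (pG t) (polynomial_fun_trace (polynomial_mx_mul (polynomial_mx_mul (pP t s) (pf 0%N)) (pQ t s))).
transitivity (ext_mean (fun x =>
    (\sum_(s <- S 0%N) G0 x * \tr (P 0%N s x) * \tr (Q 0%N s x)) +
    \sum_(1 <= t < p.+1) \sum_(s <- S t)
      G t x * \tr (P t s x * f 0%N x * Q t s x))); last first.
  rewrite ext_meanD; [|exact: polynomial_fun_sum|by apply: polynomial_fun_sum => t; exact: polynomial_fun_sum].
  rewrite ext_mean_sum//; congr (_ + _); rewrite ext_mean_sum; last by move=> t; exact: polynomial_fun_sum.
  by apply: eq_bigr => t _; rewrite ext_mean_sum.
congr ext_mean; apply/funext => x.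
under eq_bigr do rewrite big_split.
rewrite big_split /=; congr (_ + _).
  transitivity (G0 x * \sum_(s <- S 0%N) \tr (P 0%N s x) * \tr (Q 0%N s x)).
    under eq_bigr do rewrite -mulr_suml.
    rewrite -mulr_suml mulrC; congr (_ * _).
    rewrite /f'; under eq_bigr do under eq_bigr do rewrite summxE.
    under eq_bigr do rewrite exchange_big /=.
    rewrite exchange_big /=; apply: eq_bigr => s _.
    exact: sum_delta_trace.
  by rewrite mulr_sumr; apply: eq_bigr => s _; rewrite mulrA.
under eq_bigr do under eq_bigr do rewrite mulr_sumr.
under eq_bigr do rewrite exchange_big /=.
rewrite exchange_big /=; apply: eq_bigr => t _.
transitivity (G t x * \sum_(s <- S t) \tr (P t s x * f 0%N x * Q t s x)).
  under eq_bigr do under eq_bigr do rewrite mulrCA.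
  under eq_bigr do rewrite -mulr_sumr.
  rewrite -mulr_sumr; congr (_ * _).
  rewrite /f'; under eq_bigr do under eq_bigr do rewrite raddf_sum mulr_sumr.
  under eq_bigr do rewrite exchange_big /=.
  rewrite exchange_big /=; apply: eq_bigr => s _.
  exact: sum_trace_delta.
by rewrite mulr_sumr.
Qed.

End extended_expectation.
Theorem theorem3p1 (R : realType) (n : nat) (hn : (1 <= n)%N)
    (a1 a2 g : R[i]) (hdelta : delta a1 a2 g != 0)
    (p : nat) (len : nat -> nat) (k l : nat -> nat -> nat) :
  let f (t : nat) (A B : 'M[R[i]]_n) : 'M[R[i]]_n :=
    word (k t) (l t) 1 (len t).+1 A B in
  let pre (t r : nat) (A B : 'M[R[i]]_n) : 'M[R[i]]_n :=
    word (k t) (l t) 1 r A B in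
  let post (t r : nat) (A B : 'M[R[i]]_n) : 'M[R[i]]_n :=
    word (k t) (l t) r.+1 (len t).+1 A B in
  let G0 (A B : 'M[R[i]]_n) : R[i] :=
    \prod_(1 <= u < p.+1) \tr (f u A B) in
  let G (t : nat) (A B : 'M[R[i]]_n) : R[i] :=
    \prod_(1 <= u < p.+1 | u != t) \tr (f u A B) in
  let E (F : 'M[R[i]]_n -> 'M[R[i]]_n -> R[i]) : R[i] :=
    expectH F a1 a2 g in
  (a1 * E (fun A B => G0 A B * \tr (A * f 0%N A B))
     + g * E (fun A B => G0 A B * \tr (B * f 0%N A B))
   = \sum_(1 <= r < (len 0%N).+1) \sum_(0 <= j < k 0%N r)
       E (fun A B => G0 A B
            * \tr (pre 0%N r A B * A ^+ j)
            * \tr (A ^+ (k 0%N r - j - 1)%N * B ^+ l 0%N r * post 0%N r A B))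
     + \sum_(1 <= t < p.+1) \sum_(1 <= r < (len t).+1) \sum_(0 <= j < k t r)
       E (fun A B => G t A B
            * \tr (pre t r A B * A ^+ j * f 0%N A B
                     * A ^+ (k t r - j - 1)%N * B ^+ l t r * post t r A B)))
  /\
  (a2 * E (fun A B => G0 A B * \tr (B * f 0%N A B))
     + g * E (fun A B => G0 A B * \tr (A * f 0%N A B))
   = \sum_(1 <= r < (len 0%N).+1) \sum_(0 <= j < l 0%N r)
       E (fun A B => G0 A B
            * \tr (pre 0%N r A B * A ^+ k 0%N r * B ^+ j)
            * \tr (B ^+ (l 0%N r - j - 1)%N * post 0%N r A B))
     + \sum_(1 <= t < p.+1) \sum_(1 <= r < (len t).+1) \sum_(0 <= j < l t r)
       E (fun A B => G t A B
            * \tr (pre t r A B * A ^+ k t r * B ^+ j * f 0%N A B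
                     * B ^+ (l t r - j - 1)%N * post t r A B))).
Proof.
move=> f pre post G0 G E.
have pf t : polynomial_mx (fun x => f t (herm_of true x) (herm_of false x)) by exact: polynomial_mx_word.
have pG0 : polynomial_fun (fun x => G0 (herm_of true x) (herm_of false x)).
  by apply: polynomial_fun_prod => t; exact: polynomial_fun_trace.
have pG t : polynomial_fun (fun x => G t (herm_of true x) (herm_of false x)).
  by apply: polynomial_fun_prod => u; exact: polynomial_fun_trace.
have pX c m : polynomial_mx (fun x => herm_of c x ^+ m : 'M[R[i]]_n).
  by apply: polynomial_mx_exp; exact: polynomial_mx_herm_of.
have pW t r s : polynomial_mx (fun x =>
    word (k t) (l t) r s (herm_of true x) (herm_of false x) : 'M[R[i]]_n).
  exact: polynomial_mx_word.
split.
  (* A cut [s = (r, j)] removes one letter [A] of block [r], the one preceded by [j] others in that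
     block; [P] and [Q] are the words before and after it. *)
  pose P t (s : nat * nat) (x : (n * n).-tuple (measurableTypeR R) * (n * n).-tuple (measurableTypeR R)) :=
    pre t s.1 (herm_of true x) (herm_of false x) * herm_of true x ^+ s.2.
  pose Q t (s : nat * nat) (x : (n * n).-tuple (measurableTypeR R) * (n * n).-tuple (measurableTypeR R)) :=
    herm_of true x ^+ (k t s.1 - s.2 - 1)%N * herm_of false x ^+ l t s.1 *
    post t s.1 (herm_of true x) (herm_of false x).
  pose S t := [seq (r, j) | r <- index_iota 1 (len t).+1, j <- index_iota 0 (k t r)].
  have pP t s : polynomial_mx (P t s) by exact: polynomial_mx_mul (pW _ _ _) (pX _ _).
  have pQ t s : polynomial_mx (Q t s).
    exact: polynomial_mx_mul (polynomial_mx_mul (pX _ _) (pX _ _)) (pW _ _ _).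
  have df t i j : mder true i j (fun x => f t (herm_of true x) (herm_of false x))
      (fun x => \sum_(s <- S t) P t s x * delta_mx j i * Q t s x).
    apply: (mder_ext (@mder_word_true R n i j (k t) (l t) (len t).+1)) => x //=.
    by rewrite big_allpairs_dep.
  have := loop_equation hn hdelta p pf pP pQ df => /= LE.
  rewrite /E !expectH_ext_mean//; last 2 first.
  - by apply: polynomial_fun_mul => //; apply: polynomial_fun_trace; apply: polynomial_mx_mul => //; exact: polynomial_mx_herm_of.
  - by apply: polynomial_fun_mul => //; apply: polynomial_fun_trace; apply: polynomial_mx_mul => //; exact: polynomial_mx_herm_of.
  rewrite [LHS]LE big_allpairs_dep; congr (_ + _).
    apply: eq_bigr => r _; apply: eq_bigr => j _; rewrite expectH_ext_mean//.
    apply: polynomial_fun_mul; last exact: polynomial_fun_trace (pQ 0%N (r, j)).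
    by apply: polynomial_fun_mul => //; exact: polynomial_fun_trace (pP 0%N (r, j)).
  apply: eq_bigr => t _; rewrite big_allpairs_dep.
  apply: eq_bigr => r _; apply: eq_bigr => j _; rewrite expectH_ext_mean//.
    by congr ext_mean; apply/funext => x; rewrite /P /Q /= !mulrA.
  apply: polynomial_fun_mul => //; apply: polynomial_fun_trace.
  by repeat apply: polynomial_mx_mul => //; try exact: pX; try exact: pW; exact: pf.
(* For the second matrix the removed letter is a [B], so the whole power of [A] in block [r] belongs
   to the word before the cut. *)
pose P t (s : nat * nat) (x : (n * n).-tuple (measurableTypeR R) * (n * n).-tuple (measurableTypeR R)) :=
  pre t s.1 (herm_of true x) (herm_of false x) * herm_of true x ^+ k t s.1 *
  herm_of false x ^+ s.2.
pose Q t (s : nat * nat) (x : (n * n).-tuple (measurableTypeR R) * (n * n).-tuple (measurableTypeR R)) :=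
  herm_of false x ^+ (l t s.1 - s.2 - 1)%N *
  post t s.1 (herm_of true x) (herm_of false x).
pose S t := [seq (r, j) | r <- index_iota 1 (len t).+1, j <- index_iota 0 (l t r)].
have pP t s : polynomial_mx (P t s).
  exact: polynomial_mx_mul (polynomial_mx_mul (pW _ _ _) (pX _ _)) (pX _ _).
have pQ t s : polynomial_mx (Q t s) by exact: polynomial_mx_mul (pX _ _) (pW _ _ _).
have df t i j : mder false i j (fun x => f t (herm_of true x) (herm_of false x))
    (fun x => \sum_(s <- S t) P t s x * delta_mx j i * Q t s x).
  apply: (mder_ext (@mder_word_false R n i j (k t) (l t) (len t).+1)) => x //=.
  by rewrite big_allpairs_dep.
have := loop_equation hn hdelta p pf pP pQ df => /= LE.
rewrite /E !expectH_ext_mean//; last 2 first.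
- by apply: polynomial_fun_mul => //; apply: polynomial_fun_trace; apply: polynomial_mx_mul => //; exact: polynomial_mx_herm_of.
- by apply: polynomial_fun_mul => //; apply: polynomial_fun_trace; apply: polynomial_mx_mul => //; exact: polynomial_mx_herm_of.
rewrite [LHS]LE big_allpairs_dep; congr (_ + _).
  apply: eq_bigr => r _; apply: eq_bigr => j _; rewrite expectH_ext_mean//.
  apply: polynomial_fun_mul; last exact: polynomial_fun_trace (pQ 0%N (r, j)).
  by apply: polynomial_fun_mul => //; exact: polynomial_fun_trace (pP 0%N (r, j)).
apply: eq_bigr => t _; rewrite big_allpairs_dep.
apply: eq_bigr => r _; apply: eq_bigr => j _; rewrite expectH_ext_mean//.
  by congr ext_mean; apply/funext => x; rewrite /P /Q /= !mulrA.
apply: polynomial_fun_mul => //; apply: polynomial_fun_trace.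
by repeat apply: polynomial_mx_mul => //; try exact: pX; try exact: pW; exact: pf.
Qed.
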